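(* Let $u:\mathbb{R}^2\to\mathbb{R}$ be a smooth solution of $-\Delta u = x_1e^{u}$ in $\mathbb{R}^2$ such that $u(x)\le u(0)=0$ on $\mathbb{R}^2$, $\int_{\mathbb{R}^2}|x_1|e^{u}\,dx<\infty$ and $\int_{\mathbb{R}^2}x_1e^{u}\,dx>0$. Let $v=v_0-v_1$ be as defined in the context. Then $u+v$ is constant on $\mathbb{R}^2$.
   Context: Write $K(x)=x_1$, $K_+(x)=\max(x_1,0)$, $K_-(x)=\max(-x_1,0)$. Define $$v_0(x)=\frac{1}{2\pi}\int_{\mathbb{R}^2}\log\frac{|x-y|}{|y|}\,K_+(y)e^{u(y)}\,dy,\qquad v_1(x)=\frac{1}{2\pi}\int_{\mathbb{R}^2}\log\frac{|x-y|}{|y|}\,K_-(y)e^{u(y)}\,dy,$$ and $v=v_0-v_1$. *)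

(* Defs.v *)
From HB Require Import structures.
From mathcomp Require Import all_boot all_order all_algebra.
From mathcomp Require Import all_classical all_reals all_analysis.
Set Implicit Arguments. Unset Strict Implicit. Unset Printing Implicit Defensive.
Import Order.TTheory GRing.Theory Num.Theory.
Import numFieldNormedType.Exports.
Local Open Scope ring_scope.

Section Defs.
Variable R : realType.

(* Euclidean norm on R^2 (the canonical norm on R*R in the library is the max norm). *)
Definition enorm (x : R * R) : R := Num.sqrt (x.1 ^+ 2 + x.2 ^+ 2).

Definition pd1 (f : R * R -> R) : R * R -> R :=
  fun x => derive1 (fun t => f (t, x.2)) x.1.
Definition pd2 (f : R * R -> R) : R * R -> R :=
  fun x => derive1 (fun t => f (x.1, t)) x.2.

Definition pdir (b : bool) := if b then pd1 else pd2.
Definition iter_pd (s : seq bool) (f : R * R -> R) := foldr pdir f s.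

Definition smooth2 (f : R * R -> R) : Prop :=
  forall s : seq bool,
    continuous (iter_pd s f) /\
    (forall x : R * R, derivable (fun t => iter_pd s f (t, x.2)) x.1 1 /\
                       derivable (fun t => iter_pd s f (x.1, t)) x.2 1).

Definition laplacian (f : R * R -> R) : R * R -> R :=
  fun x => pd1 (pd1 f) x + pd2 (pd2 f) x.

Definition leb2 := ((@lebesgue_measure R) \x (@lebesgue_measure R))%E.

Definition Kp (y : R * R) : R := Num.max y.1 0.
Definition Km (y : R * R) : R := Num.max (- y.1) 0.

Definition v0 (u : R * R -> R) (x : R * R) : R :=
  (2 * pi)^-1 * Rintegral leb2 setT
    (fun y => ln (enorm (x - y) / enorm y) * Kp y * expR (u y)).
Definition v1 (u : R * R -> R) (x : R * R) : R :=
  (2 * pi)^-1 * Rintegral leb2 setT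
    (fun y => ln (enorm (x - y) / enorm y) * Km y * expR (u y)).
Definition vv (u : R * R -> R) (x : R * R) : R := v0 u x - v1 u x.

End Defs.

(* Main.v *)
Require Import Defs.
From HB Require Import structures.
From mathcomp Require Import all_boot all_order all_algebra.
From mathcomp Require Import all_classical all_reals all_analysis.
From mathcomp Require Import measurable_realfun ring lra.
Set Implicit Arguments. Unset Strict Implicit. Unset Printing Implicit Defensive.
Import Order.TTheory GRing.Theory Num.Theory.
Import numFieldNormedType.Exports.
Local Open Scope classical_set_scope.
Local Open Scope ring_scope.

(** Write [f y = y_1 exp (u y)] and let [D] be the closed disc of radius [r]
centred at [a].  Green's identity in [D] against
[ln (|x - a|^2 / r^2) - (|x - a|^2 / r^2 - 1)], which vanishes to second order
on the boundary circle, expresses [u a] as the mean of [u] over [D] plus an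
integral of [f] over [D].  Since the mean over [D] of [x |-> ln |x - y|^2] is
[ln |a - y|^2] corrected by the same function, adding [v a] gives, for every
[r], with [nu] that mean,
  [4 pi (u a + v a) = 4 / r^2 * \int_D u + \int f(y) (nu(y) - ln |y|^2) dy].
Compare this at [a] with radius [r] and at [b] with radius [r + d], where
[d >= |a - b|], so that the first disc lies in the second.  As [u <= 0], the
integral of [u] over the larger disc is the smaller one.  The potential terms
are [O(ln r)] and differ by [O(1 / r)], and letting [r] tend to infinity
yields [u b + v b <= u a + v a] for all [a] and [b]. *)

Section Plane.
Variable R : realType.
Notation leb := (@lebesgue_measure R).
Notation leb2 := (@lebesgue_measure R \x @lebesgue_measure R)%E.
(* [lebesgue_measure] lives on [measurableTypeR R], whose measurable structure
   has a display different from the canonical one of [R]. *)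
Notation P2 := (measurableTypeR R * measurableTypeR R)%type.

(** * Discs in the plane *)

(** An open set is the union of the countably many boxes with rational centre and radius
    [1 / (n + 1)] that it contains, and each box is a measurable rectangle. *)
Lemma open_measurable_prod (O : set (R * R)) : open O -> measurable (O : set P2).
Proof.
move=> oO.
pose box (i : rat * rat * nat) : set P2 :=
  ball (ratr i.1.1 : R) i.2.+1%:R^-1 `*` ball (ratr i.1.2 : R) i.2.+1%:R^-1.
pose F n : set P2 := if unpickle n is Some i then
  if `[< box i `<=` O >] then box i else set0 else set0.
have -> : O = \bigcup_n F n.
  apply/seteqP; split=> [x Ox|x [n _]]; last first.
    rewrite /F; case: (unpickle n) => [i|//].
    by case: asboolP => // iO; exact: iO.
  have : nbhs x O by exact: open_nbhs_nbhs.
  move=> /nbhs_ballP [e /= e0 eO].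
  (* Two steps of length [1 / (n + 1)], from [x] to the centre and from there to any point of the
     box, stay below [e]. *)
  have [n ne] : exists n : nat, n.+1%:R^-1 < e / 2.
    have e20 : 0 < e / 2 by rewrite divr_gt0.
    have [n _ nP] := near_infty_natSinv_lt (PosNum e20).
    by exists n; exact: (nP n (leqnn n)).
  have n0 : (0 : R) < n.+1%:R^-1 by rewrite invr_gt0 ltr0n.
  have [q1 q1P] : exists q, ratr q \in `]x.1, (x.1 + n.+1%:R^-1)[.
    by apply: rat_in_itvoo; rewrite ltrDl.
  have [q2 q2P] : exists q, ratr q \in `]x.2, (x.2 + n.+1%:R^-1)[.
    by apply: rat_in_itvoo; rewrite ltrDl.
  exists (pickle (q1, q2, n)); [exact: I|rewrite /F pickleK].
  move: q1P q2P; rewrite !in_itv/= => /andP[q11 q12] /andP[q21 q22].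
  have bx : box (q1, q2, n) x.
    by split; rewrite /= /ball/= gtr0_norm ?subr_gt0// ltrBlDl.
  case: asboolP => // nO; exfalso; apply: nO => y [/=].
  have tri (p q r : R) : p < q -> q < p + n.+1%:R^-1 ->
      ball q n.+1%:R^-1 r -> ball p e r.
    rewrite /ball/= => pq qp qr; apply: le_lt_trans (ler_distD q p r) _.
    by rewrite (splitr e) ltrD// (lt_trans _ ne)// ltr0_norm ?subr_lt0// opprB ltrBlDl.
  by move=> y1 y2; apply: eO; split; [exact: tri y1|exact: tri y2].
apply: bigcupT_measurable => n; rewrite /F.
case: (unpickle n) => [i|]; last exact: measurable0.
case: asboolP => _; last exact: measurable0.
by apply: measurableX; apply: open_measurable; apply: ball_open; rewrite invr_gt0.
Qed.

Lemma continuous_measurable_prod (f : R * R -> R) :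
  continuous f -> measurable_fun (setT : set P2) f.
Proof.
move=> cf.
apply: (measurability _ (RGenOpens.measurableE R)).
move=> _ [_ [a [b ->] <-]].
apply: open_measurable_prod; rewrite setTI.
by apply: open_comp; [move=> x _; exact: cf|exact: interval_open].
Qed.

Definition sqd (a y : R * R) : R := (y.1 - a.1) ^+ 2 + (y.2 - a.2) ^+ 2.
(** [T] is the squared radius, so that chords are cut out by a polynomial inequality. *)
Definition disc (a : R * R) (T : R) : set P2 := [set y | sqd a y <= T].

Lemma sqd_ge0 a y : 0 <= sqd a y.
Proof. by rewrite /sqd addr_ge0// sqr_ge0. Qed.

Lemma continuous_sqd a : continuous (sqd a).
Proof.
move=> y; rewrite /sqd; apply: cvgD; apply: cvgM; apply: cvgB; try exact: cvg_cst;
  by [exact: cvg_fst|exact: cvg_snd].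
Qed.

Lemma measurable_disc a T : measurable (disc a T).
Proof.
rewrite (_ : disc a T = sqd a @^-1` `]-oo, T]); last first.
  by apply/seteqP; split => y /=; rewrite in_itv.
rewrite -[X in measurable X]setTI.
by apply: continuous_measurable_prod => //; exact: continuous_sqd.
Qed.

Lemma disc_sub_box a T :
  disc a T `<=` `[a.1 - Num.sqrt T, a.1 + Num.sqrt T] `*`
                `[a.2 - Num.sqrt T, a.2 + Num.sqrt T].
Proof.
move=> y; rewrite /disc/sqd/= => yT.
have := sqr_ge0 (y.1 - a.1); have := sqr_ge0 (y.2 - a.2) => y2 y1.
have l1 : `|y.1 - a.1| <= Num.sqrt T by rewrite -sqrtr_sqr ler_wsqrtr//; lra.
have l2 : `|y.2 - a.2| <= Num.sqrt T by rewrite -sqrtr_sqr ler_wsqrtr//; lra.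
by move: l1 l2; rewrite !ler_norml !in_itv/= => /andP[? ?] /andP[? ?]; split; lra.
Qed.

(** A crude bound by a square. Integrability on discs rests on it, and the exact value in
    [disc_area] in turn needs that integrability for Fubini. *)
Lemma disc_finite a T : (leb2 (disc a T) < +oo)%E.
Proof.
apply: (@le_lt_trans _ _ (leb2 (`[a.1 - Num.sqrt T, a.1 + Num.sqrt T] `*`
                `[a.2 - Num.sqrt T, a.2 + Num.sqrt T]))).
- apply: le_measure; last exact: disc_sub_box.
  + by rewrite inE; exact: measurable_disc.
  + by rewrite inE; apply: measurableX; exact: measurable_itv.
have fin c r : leb `[c - r, c + r] \is a fin_num.
  by rewrite lebesgue_measure_itv; case: ifP.
by rewrite product_measure1E ?measurable_itv// -ge0_fin_numE ?mule_ge0// fin_numM ?fin.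
Qed.

Lemma disc_bounded a T (f : R * R -> R) : continuous f ->
  exists M, 0 <= M /\ forall y, disc a T y -> `|f y| <= M.
Proof.
move=> cf.
have cK := compact_setX (@segment_compact R (a.1 - Num.sqrt T) (a.1 + Num.sqrt T))
                  (@segment_compact R (a.2 - Num.sqrt T) (a.2 + Num.sqrt T)).
have := continuous_compact (continuous_subspaceT cf) cK.
move=> /compact_bounded [M [_ MP]].
exists (`|M| + 1); split; first by rewrite addr_ge0.
move=> y /disc_sub_box yB; apply: (MP (`|M| + 1)).
  by rewrite (le_lt_trans (ler_norm M))// ltrDl.
by exists y.
Qed.

Lemma disc_integrable a T (f : R * R -> R) : measurable_fun (setT : set P2) f ->
  (exists M, forall y, disc a T y -> `|f y| <= M) ->
  leb2.-integrable (disc a T) (EFin \o f).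
Proof.
move=> mf [M MP]; apply: measurable_bounded_integrable.
- exact: measurable_disc.
- exact: disc_finite.
- exact: measurable_funS mf.
- exists M; split; first exact: num_real.
  by move=> N MN y /MP /le_trans; apply; exact: ltW.
Qed.

Lemma continuous_disc_integrable a T (f : R * R -> R) : continuous f ->
  leb2.-integrable (disc a T) (EFin \o f).
Proof.
move=> cf; apply: disc_integrable; first exact: continuous_measurable_prod.
by have [M [_ MP]] := disc_bounded a T cf; exists M.
Qed.

(** The inner domain keeps the shape [(t - c) ^+ 2 + k <= T] expected by [green_slice] and
    [slice_length]; [disc_fubini_y] swaps the two squares for the same reason. *)
Lemma disc_fubini_x a T (f : R * R -> R) :
  leb2.-integrable (disc a T) (EFin \o f) ->
  (\int[leb2]_(z in disc a T) (f z)%:E = \int[leb]_y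
    \int[leb]_(x in [set x | ((x - a.1) ^+ 2 + (y - a.2) ^+ 2 <= T)%R]) (f (x, y))%:E)%E.
Proof.
move=> fi0; have fi := (integrable_mkcond _ (measurable_disc a T)).1 fi0.
rewrite integral_mkcond -(integral21_prod_meas1 fi).
by apply: eq_integral => y _; rewrite [RHS]integral_mkcond.
Qed.

Lemma disc_fubini_y a T (f : R * R -> R) :
  leb2.-integrable (disc a T) (EFin \o f) ->
  (\int[leb2]_(z in disc a T) (f z)%:E = \int[leb]_x
    \int[leb]_(y in [set y | ((y - a.2) ^+ 2 + (x - a.1) ^+ 2 <= T)%R]) (f (x, y))%:E)%E.
Proof.
move=> fi0; have fi := (integrable_mkcond _ (measurable_disc a T)).1 fi0.
rewrite integral_mkcond -(integral12_prod_meas1 fi).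
apply: eq_integral => x _; rewrite [RHS]integral_mkcond; apply: eq_integral => y _.
rewrite /= !patchE; congr (if _ then _ else _).
by apply/idP/idP; rewrite !inE /disc/sqd/= addrC.
Qed.

(** * Green's identity with a regularised kernel *)

Lemma is_derive_continuous (f df : R -> R) :
  (forall x : R, is_derive x 1 f (df x)) -> continuous f.
Proof.
by move=> fd x; apply: differentiable_continuous; apply/derivable1_diffP; exact: ex_derive.
Qed.

Lemma C1_FTC2 (F f : R -> R) a b : a <= b ->
  (forall x : R, is_derive x 1 F (f x)) -> continuous f ->
  (\int[leb]_(x in `[a, b]) (f x)%:E = (F b - F a)%:E)%E.
Proof.
rewrite le_eqVlt => /predU1P[-> _ _|ab dF cf].
  by rewrite set_itv1 integral_set1 subrr.
have cF := is_derive_continuous dF.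
rewrite (@continuous_FTC2 _ f F)//.
- exact: continuous_subspaceT.
- split; first by move=> x _; exact: ex_derive.
  + exact: cvg_at_right_filter (cF a).
  + exact: cvg_at_left_filter (cF b).
- by move=> x _; rewrite derive1E; exact: derive_val.
Qed.

(* As a function of [s = |x - a|^2], [gam T e] regularises
   [ln (s / T) - (s / T - 1)]; it vanishes to second order at [s = T], so that
   no boundary terms appear in Green's identity. *)
Definition gam (T e s : R) := ln (s + e) - ln (T + e) - (s - T) / (T + e).
Definition gam1 (T e s : R) := (s + e)^-1 - (T + e)^-1.
Definition gam2 (e s : R) := - (s + e) ^- 2.

Lemma is_derive_gam (T e s : R) : 0 < s + e -> is_derive s 1 (gam T e) (gam1 T e s).
Proof.
move=> se; rewrite /gam.
have d1 : is_derive s 1 (fun s => s + e) 1.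
  by apply: is_derive_eq; rewrite addr0.
have d2 : is_derive s 1 (fun s => ln (s + e)) ((s + e)^-1 * 1).
  exact: (@is_derive1_comp _ (@ln R) (fun s => s + e) _ _ _ (is_derive1_ln se) d1).
apply: (@is_derive_eq _ _ _ (fun s => ln (s + e) - ln (T + e) - (s - T) / (T + e))).
by rewrite /gam1/= /GRing.scale/= mulr1 subr0 oppr0 addr0 mulr0 add0r mulr1.
Qed.

Lemma is_derive_gam1 (T e s : R) : 0 < s + e -> is_derive s 1 (gam1 T e) (gam2 e s).
Proof.
move=> se; rewrite /gam1.
have d1 : is_derive s 1 (fun s => s + e) 1.
  by apply: is_derive_eq; rewrite addr0.
have d2 : is_derive s 1 (fun s => (s + e)^-1) (- (s + e) ^- 2 *: 1).
  by apply: (@is_deriveV _ (fun s => s + e)) => //; exact: lt0r_neq0.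
apply: (@is_derive_eq _ _ _ (fun s => (s + e)^-1 - (T + e)^-1)).
by rewrite /gam2 /GRing.scale/= mulr1 subr0.
Qed.

Lemma continuous_gam2 (e s : R) : 0 < s + e -> {for s, continuous (gam2 e)}.
Proof.
move=> se; apply: cvgN; apply: cvgV; first by rewrite expf_neq0// lt0r_neq0.
by apply: cvgM; (apply: cvgD; [exact: cvg_id|exact: cvg_cst]).
Qed.

Lemma slice_itv (c k T : R) : k <= T ->
  [set t | (t - c) ^+ 2 + k <= T] =
  [set` `[c - Num.sqrt (T - k), c + Num.sqrt (T - k)]].
Proof.
move=> kT; pose X := Num.sqrt (T - k); rewrite -/X.
have XX : X ^+ 2 = T - k by rewrite sqr_sqrtr// subr_ge0.
have X0 : 0 <= X by exact: sqrtr_ge0.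
apply/seteqP; split => t /=; rewrite in_itv/=.
  rewrite -lerBrDr -XX => /(ler_wsqrtr); rewrite !sqrtr_sqr (ger0_norm X0).
  by rewrite ler_norml => /andP[? ?]; apply/andP; split; lra.
move=> /andP[? ?]; rewrite -lerBrDr -XX -[leLHS]real_normK ?num_real//.
by rewrite ler_sqr ?nnegrE// ler_norml; apply/andP; split; lra.
Qed.

(** With [S t = (t - c) ^+ 2 + k], the factor of [W t] is the second derivative of [gam T e \o S],
    so the integrand is the derivative of [F] below. At both ends of the chord [S = T], where [gam]
    and [gam1] vanish, hence so does [F]. *)
Lemma green_slice (T e c k : R) (W W1 W2 : R -> R) : 0 < e -> 0 <= k ->
  (forall x : R, is_derive x 1 W (W1 x)) -> (forall x : R, is_derive x 1 W1 (W2 x)) ->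
  continuous W2 ->
  (\int[leb]_(t in [set t | ((t - c) ^+ 2 + k <= T)%R])
    (gam T e ((t - c) ^+ 2 + k) * W2 t
     - (2 * gam1 T e ((t - c) ^+ 2 + k)
        + 4 * (t - c) ^+ 2 * gam2 e ((t - c) ^+ 2 + k)) * W t)%:E = 0)%E.
Proof.
move=> e0 k0 dW dW1 cW2.
have [Tk|kT] := ltP T k.
  rewrite (_ : mkset _ = set0) ?integral_set0//.
  by apply/seteqP; split => // t /=; have := sqr_ge0 (t - c); lra.
pose X := Num.sqrt (T - k).
have XX : X ^+ 2 = T - k by rewrite sqr_sqrtr// subr_ge0.
have X0 : 0 <= X by exact: sqrtr_ge0.
rewrite slice_itv// -/X.
pose S t := (t - c) ^+ 2 + k.
have Se t : 0 < S t + e by rewrite ltr_wpDl// addr_ge0// sqr_ge0.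
have dS (t : R) : is_derive t 1 S (2 * (t - c)).
  rewrite /S; apply: is_derive_eq.
  by rewrite /GRing.scale/= subr0 addr0; ring.
have dg (t : R) : is_derive t 1 (gam T e \o S) (gam1 T e (S t) * (2 * (t - c))).
  exact: (is_derive1_comp (is_derive_gam T (Se t))).
have dg1 (t : R) : is_derive t 1 (gam1 T e \o S) (gam2 e (S t) * (2 * (t - c))).
  exact: (is_derive1_comp (is_derive_gam1 T (Se t))).
have cS := is_derive_continuous dS.
have cW := is_derive_continuous dW.
have cg := is_derive_continuous dg.
have cg1 := is_derive_continuous dg1.
pose F t := (gam T e \o S) t * W1 t - 2 * (t - c) * (gam1 T e \o S) t * W t.
have F0 x : S x = T -> F x = - (2 * (x - c) * (gam1 T e \o S) x * W x) /\ 
    (gam1 T e \o S) x = 0.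
  by move=> /= Sx; rewrite /F/= Sx /gam /gam1 !subrr mul0r subrr mul0r sub0r.
have [Fa Fa0] : F (c - X) = 0 /\ F (c + X) = 0.
  have [|-> ->] := F0 (c - X); first by rewrite /S (_ : c - X - c = - X) ?sqrrN ?XX ?subrK//; ring.
  have [|-> ->] := F0 (c + X); first by rewrite /S (_ : c + X - c = X) ?XX ?subrK//; ring.
  by rewrite !mulr0 !mul0r oppr0.
transitivity (F (c + X) - F (c - X))%:E; last by rewrite Fa Fa0 subrr.
apply: C1_FTC2.
- lra.
- move=> t; apply: is_derive_eq; rewrite /GRing.scale/=.
  by rewrite -/(S t) !subr0; ring.
- move=> t; apply: cvgB; apply: cvgM.
  + exact: cg.
  + exact: cW2.
  + apply: cvgD; apply: cvgM; [exact: cvg_cst|exact: cg1| |].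
      apply: cvgM; [exact: cvg_cst|].
      by apply: cvgM; (apply: cvgB; [exact: cvg_id|exact: cvg_cst]).
    by apply: (continuous_comp (cS t)); exact: continuous_gam2.
  + exact: cW.
Qed.

Lemma sqdDe_gt0 (a z : R * R) e : 0 < e -> 0 < sqd a z + e.
Proof. by move=> e0; rewrite ltr_wpDl// sqd_ge0. Qed.

Lemma continuous_gam_sqd (a : R * R) (T e : R) : 0 < e ->
  continuous (fun z : R * R => gam T e (sqd a z)).
Proof.
move=> e0 z; apply: (continuous_comp (@continuous_sqd a z)).
have d := is_derive_gam T (sqdDe_gt0 a z e0).
by apply: differentiable_continuous; apply/derivable1_diffP; exact: ex_derive.
Qed.

Lemma continuous_gam1_sqd (a : R * R) (T e : R) : 0 < e ->
  continuous (fun z : R * R => gam1 T e (sqd a z)).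
Proof.
move=> e0 z; apply: (continuous_comp (@continuous_sqd a z)).
have d := is_derive_gam1 T (sqdDe_gt0 a z e0).
by apply: differentiable_continuous; apply/derivable1_diffP; exact: ex_derive.
Qed.

Lemma continuous_gam2_sqd (a : R * R) (e : R) : 0 < e ->
  continuous (fun z : R * R => gam2 e (sqd a z)).
Proof.
move=> e0 z; apply: (continuous_comp (@continuous_sqd a z)).
exact: continuous_gam2 (sqdDe_gt0 a z e0).
Qed.

Lemma continuous_slice1 (f : R * R -> R) (y : R) :
  continuous f -> continuous (fun x : R => f (x, y)).
Proof.
move=> cf x; apply: (@cvg_comp _ _ _ (fun x : R => (x, y)) f _ (nbhs (x, y))); last exact: cf.
by apply: (@cvg_pair _ _ _ (nbhs x) (nbhs x) (nbhs y) _ _ _ id (cst y)) => //; exact: cvg_cst.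
Qed.

Lemma continuous_slice2 (f : R * R -> R) (x : R) :
  continuous f -> continuous (fun y : R => f (x, y)).
Proof.
move=> cf y; apply: (@cvg_comp _ _ _ (fun y : R => (x, y)) f _ (nbhs (x, y))); last exact: cf.
by apply: (@cvg_pair _ _ _ (nbhs y) (nbhs x) (nbhs y) _ _ _ (cst x) id) => //; exact: cvg_cst.
Qed.

(** The slice identities in both directions, integrated by Fubini, move the Laplacian onto the
    radial kernel. At [s = sqd a z] the kernel has Laplacian [4 gam1 + 4 s gam2 = 4 e / (s + e)^2 -
    4 / (T + e)], whose first term concentrates at [a] as [e] tends to 0. *)
Lemma green_eps (a : R * R) (T e : R) (w wx wxx wy wyy : R * R -> R) : 0 < e ->
  (forall x y : R, is_derive x 1 (fun t => w (t, y)) (wx (x, y))) ->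
  (forall x y : R, is_derive x 1 (fun t => wx (t, y)) (wxx (x, y))) ->
  (forall x y : R, is_derive y 1 (fun t => w (x, t)) (wy (x, y))) ->
  (forall x y : R, is_derive y 1 (fun t => wy (x, t)) (wyy (x, y))) ->
  continuous w -> continuous wxx -> continuous wyy ->
  \int[leb2]_(z in disc a T) (gam T e (sqd a z) * (wxx z + wyy z)) =
  \int[leb2]_(z in disc a T) (4 * e / (sqd a z + e) ^+ 2 * w z)
  - 4 / (T + e) * \int[leb2]_(z in disc a T) w z.
Proof.
move=> e0 dx dxx dy dyy cw cxx cyy.
have cg := @continuous_gam_sqd a T e e0.
have cg1 := @continuous_gam1_sqd a T e e0.
have cg2 := @continuous_gam2_sqd a e e0.
have cc1 : continuous (fun z : R * R => (z.1 - a.1) ^+ 2).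
  by move=> z; apply: cvgM; (apply: cvgB; [exact: cvg_fst|exact: cvg_cst]).
have cc2 : continuous (fun z : R * R => (z.2 - a.2) ^+ 2).
  by move=> z; apply: cvgM; (apply: cvgB; [exact: cvg_snd|exact: cvg_cst]).
pose K1 z := gam T e (sqd a z) * wxx z
     - (2 * gam1 T e (sqd a z)
        + 4 * (z.1 - a.1) ^+ 2 * gam2 e (sqd a z)) * w z.
pose K2 z := gam T e (sqd a z) * wyy z
     - (2 * gam1 T e (sqd a z)
        + 4 * (z.2 - a.2) ^+ 2 * gam2 e (sqd a z)) * w z.
have cK (c ww : R * R -> R) : continuous c -> continuous ww ->
  continuous (fun z : R * R => gam T e (sqd a z) * ww z
     - (2 * gam1 T e (sqd a z) + 4 * c z * gam2 e (sqd a z)) * w z).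
  move=> cc cww z; apply: cvgB; apply: cvgM; [exact: cg|exact: cww| |exact: cw].
  apply: cvgD; apply: cvgM; [exact: cvg_cst|exact: cg1| |exact: cg2].
  by apply: cvgM; [exact: cvg_cst|exact: cc].
have iK1 := continuous_disc_integrable a T (cK _ _ cc1 cxx).
have iK2 := continuous_disc_integrable a T (cK _ _ cc2 cyy).
have K10 : \int[leb2]_(z in disc a T) K1 z = 0.
  rewrite /Rintegral (disc_fubini_x iK1)/= integral0_eq// => y _.
  have cxxy := continuous_slice1 (y := y) cxx.
  exact: (green_slice T a.1 e0 (sqr_ge0 (y - a.2)) (dx ^~ y) (dxx ^~ y) cxxy).
have K20 : \int[leb2]_(z in disc a T) K2 z = 0.
  rewrite /Rintegral (disc_fubini_y iK2)/= integral0_eq// => x _.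
  have cyyx := continuous_slice2 (x := x) cyy.
  rewrite -(green_slice T a.2 e0 (sqr_ge0 (x - a.1)) (dy x) (dyy x) cyyx).
  apply: eq_integral => y _.
  by rewrite /sqd/= [(x - a.1) ^+ 2 + _]addrC.
have cD : continuous (fun z : R * R => 4 * e / (sqd a z + e) ^+ 2).
  move=> z; apply: cvgM; first exact: cvg_cst.
  apply: cvgV; first by rewrite expf_neq0// lt0r_neq0// sqdDe_gt0.
  by apply: cvgM; (apply: cvgD; [exact: continuous_sqd|exact: cvg_cst]).
have i1 : leb2.-integrable (disc a T)
    (EFin \o (fun z => gam T e (sqd a z) * (wxx z + wyy z))).
  apply: continuous_disc_integrable => z.
  by apply: cvgM; [exact: cg|apply: cvgD; [exact: cxx|exact: cyy]].
have i2 : leb2.-integrable (disc a T) (EFin \o (fun z => 4 * e / (sqd a z + e) ^+ 2 * w z)).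
  by apply: continuous_disc_integrable => z; apply: cvgM; [exact: cD|exact: cw].
have i3 : leb2.-integrable (disc a T) (EFin \o w) by exact: continuous_disc_integrable.
have i4 : leb2.-integrable (disc a T) (EFin \o (fun z => 4 / (T + e) * w z)).
  by apply: continuous_disc_integrable => z; apply: cvgM; [exact: cvg_cst|exact: cw].
have mD := measurable_disc a T.
rewrite -RintegralZl// -RintegralB//.
apply/eqP; rewrite -subr_eq0; apply/eqP.
rewrite -RintegralB//; last first.
  by apply: continuous_disc_integrable => z; apply: cvgB; apply: cvgM;
    [exact: cD|exact: cw|exact: cvg_cst|exact: cw].
transitivity (\int[leb2]_(z in disc a T) (K1 z + K2 z)).
  apply: eq_Rintegral => z _; rewrite /K1 /K2 /gam1 /gam2.
  have se : sqd a z + e != 0 by rewrite lt0r_neq0// sqdDe_gt0.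
  (* Over [(s + e)^2] the claim becomes polynomial in [s] and the remaining inverses. *)
  have -> : (sqd a z + e)^-1 = (sqd a z + e) / (sqd a z + e) ^+ 2.
    by rewrite expr2 invfM mulrA divff// mul1r.
  have := erefl (sqd a z); rewrite {1}/sqd.
  move: (sqd a z) ((sqd a z + e) ^+ 2)^-1 (T + e)^-1 (gam _ _ _) => s S1 T1 G sE.
  by rewrite -sE; ring.
by rewrite RintegralD// K10 K20 addr0.
Qed.

(** * The area of a disc *)

Lemma slice_length (c k T : R) :
  (leb [set t | ((t - c) ^+ 2 + k <= T)%R] = (2 * Num.sqrt (T - k))%:E)%E.
Proof.
have [Tk|kT] := ltP T k.
  rewrite (_ : mkset _ = set0) ?measure0.
    by rewrite ler0_sqrtr ?mulr0// subr_le0 ltW.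
  by apply/seteqP; split => // t /=; have := sqr_ge0 (t - c); lra.
have X0 : 0 <= Num.sqrt (T - k) by exact: sqrtr_ge0.
rewrite slice_itv//; move: (Num.sqrt _) X0 => X X0.
rewrite lebesgue_measure_itv/= lte_fin; case: ltP => cX.
  by rewrite -EFinB; congr EFin; ring.
by congr EFin; lra.
Qed.

Lemma integral_cos2 :
  (\int[leb]_(x in `[(- (pi / 2))%R, (pi / 2)%R]) (2 * cos x ^+ 2)%:E = (pi : R)%:E)%E.
Proof.
pose F (x : R) := x + sin x * cos x.
transitivity (F (pi / 2) - F (- (pi / 2)))%:E; last first.
  by rewrite /F cosN cos_pihalf; congr EFin; field.
apply: C1_FTC2.
- have := pi_gt0 R; lra.
- move=> x; apply: is_derive_eq; rewrite /GRing.scale/=.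
  by have := sin2cos2 x; rewrite !expr2; lra.
- move=> x; apply: cvgM; first exact: cvg_cst.
  by apply: cvgM; exact: continuous_cos.
Qed.

(** The substitution [y = c + sqrt T * sin t] turns the integrand into [2 T cos^2 t] on
    [[- pi / 2, pi / 2]]. *)
Lemma integral_half_chord (c T : R) : 0 < T ->
  (\int[leb]_y (2 * Num.sqrt (T - (y - c) ^+ 2))%:E = (pi * T)%:E)%E.
Proof.
move=> T0; pose X := Num.sqrt T.
have XX : X ^+ 2 = T by rewrite sqr_sqrtr// ltW.
have X0 : 0 < X by rewrite sqrtr_gt0.
pose G y : R := 2 * Num.sqrt (T - (y - c) ^+ 2).
transitivity (\int[leb]_(y in `[(c - X)%R, (c + X)%R]) (G y)%:E)%E.
  (* Off this interval the radicand is nonpositive and its [Num.sqrt] is 0. *)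
  rewrite [RHS]integral_mkcond; apply: eq_integral => y _.
  rewrite patchE; case: ifPn => //; rewrite notin_setE/= in_itv/= => yX.
  rewrite ler0_sqrtr ?mulr0// subr_le0 -XX -[leRHS]real_normK ?num_real//.
  rewrite ler_sqr ?nnegrE//; last exact: ltW.
  rewrite leNgt; apply/negP; rewrite ltr_norml => /andP[y1 y2]; apply: yX.
  by apply/andP; split; lra.
pose F t := c + X * sin t.
have pi0 := pi_gt0 R.
have dF (t : R) : is_derive t 1 F (X * cos t).
  by rewrite /F; apply: is_derive_eq; rewrite /GRing.scale/=; ring.
have F'E : derive1 F = (fun t => X * cos t).
  by apply/funext => t; rewrite derive1E; exact: derive_val.
have Fa : F (- (pi / 2)) = c - X by rewrite /F sinN sin_pihalf mulrN1.
have Fb : F (pi / 2) = c + X by rewrite /F sin_pihalf mulr1.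
have cF := is_derive_continuous dF.
have cc : continuous (fun t : R => X * cos t).
  by move=> t; apply: cvgM; [exact: cvg_cst|exact: continuous_cos].
rewrite -Fa -Fb integration_by_substitution_increasing; last first.
- rewrite Fa Fb; apply: continuous_subspaceT => y.
  apply: cvgM; first exact: cvg_cst.
  apply: (@continuous_comp _ _ _ (fun y => T - (y - c) ^+ 2) Num.sqrt); last exact: sqrt_continuous.
  apply: cvgB; first exact: cvg_cst.
  by apply: cvgM; (apply: cvgB; [exact: cvg_id|exact: cvg_cst]).
- split; first by move=> t _; exact: ex_derive.
  + exact: cvg_at_right_filter (cF _).
  + exact: cvg_at_left_filter (cF _).
- rewrite F'E; apply/cvg_ex; exists (X * cos (pi / 2)).
  exact: cvg_at_left_filter (cc _).
- rewrite F'E; apply/cvg_ex; exists (X * cos (- (pi / 2))).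
  exact: cvg_at_right_filter (cc _).
- by rewrite F'E => t _; exact: cc.
- by move=> t t' tI t'I tt'; rewrite /F ltrD2l ltr_pM2l// ltr_sin.
- lra.
transitivity (\int[leb]_(x in `[(- (pi / 2))%R, (pi / 2)%R]) (T%:E * (2 * cos x ^+ 2)%:E))%E.
  apply: eq_integral => t; rewrite inE/= in_itv/= => /andP[t1 t2].
  have ct : 0 <= cos t by apply: cos_ge0_pihalf; rewrite t1 t2.
  rewrite F'E -EFinM; congr EFin.
  change (2 * Num.sqrt (T - (c + X * sin t - c) ^+ 2) * (X * cos t) = T * (2 * cos t ^+ 2)).
  have -> : T - (c + X * sin t - c) ^+ 2 = (X * cos t) ^+ 2.
    by rewrite -{1}XX exprMn cos2sin2; ring.
  rewrite sqrtr_sqr ger0_norm; last by rewrite mulr_ge0// ltW.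
  by rewrite -XX; ring.
rewrite integralZl//; first by rewrite integral_cos2 -EFinM mulrC.
apply: continuous_compact_integrable; first exact: segment_compact.
apply: continuous_subspaceT => x; apply: cvgM; first exact: cvg_cst.
by apply: cvgM; exact: continuous_cos.
Qed.

Lemma disc_area (a : R * R) (T : R) : 0 < T -> leb2 (disc a T) = (pi * T)%:E.
Proof.
move=> T0; rewrite -(integral_half_chord a.2 T0).
transitivity (\int[leb2]_(z in disc a T) (1 : R)%:E)%E.
  by rewrite integral_cst ?mul1e//; exact: measurable_disc.
have i1 : leb2.-integrable (disc a T) (EFin \o cst (1 : R)).
  by apply: continuous_disc_integrable => z; exact: cvg_cst.
rewrite (disc_fubini_x i1); apply: eq_integral => y _.
transitivity (leb [set x | ((x - a.1) ^+ 2 + (y - a.2) ^+ 2 <= T)%R]); last exact: slice_length.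
rewrite /= integral_cst ?mul1e//.
rewrite (_ : mkset _ = (fun x => (x - a.1) ^+ 2 + (y - a.2) ^+ 2) @^-1` `]-oo, T]); last first.
  by apply/seteqP; split => x /=; rewrite in_itv.
rewrite -[X in measurable X]setTI.
apply: continuous_measurable_fun => //; first move=> x.
  by apply: cvgD; last exact: cvg_cst; apply: cvgM; (apply: cvgB; [exact: cvg_id|exact: cvg_cst]).
Qed.

Lemma Rintegral_disc_cst (a : R * R) (T k : R) : 0 < T ->
  \int[leb2]_(z in disc a T) k = k * (pi * T).
Proof.
move=> T0; have /(congr1 fine) E := disc_area a T0.
rewrite Rintegral_cst; first by congr (_ * _); exact: E.
exact: measurable_disc.
Qed.

(** * Removing the regularisation *)

Lemma ln_leB1 (y : R) : 0 < y -> ln y <= y - 1.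
Proof. by move=> y0; rewrite -{1}(subrKC 1 y) le_ln1Dx//; lra. Qed.

(** This is [ln q <= q - 1] at [q = (s + e) / (T + e)]. The sign makes [- gam] eligible for Fatou's
    lemma. *)
Lemma gam_le0 (T e s : R) : 0 < s + e -> s <= T -> gam T e s <= 0.
Proof.
move=> se sT; have Te : 0 < T + e by lra.
rewrite /gam subr_le0 -ln_div ?posrE//.
rewrite (le_trans (ln_leB1 _)) ?divr_gt0//.
by rewrite le_eqVlt; apply/orP; left; apply/eqP; field; rewrite lt0r_neq0.
Qed.

(** Both sides being nonpositive, [gam T 0] dominates every [gam T e] in absolute value. The
    inequality [ln q <= q - 1] at the quotient of [s / T] by [(s + e) / (T + e)] leaves the
    nonnegative gap [e (T - s)^2 / (T (T + e) (s + e))]. *)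
Lemma gam0_le (T e s : R) : 0 <= e -> 0 < s -> s <= T -> gam T 0 s <= gam T e s.
Proof.
move=> e0 s0 sT; have T0 : 0 < T by lra.
have se : 0 < s + e by lra.
have Te : 0 < T + e by lra.
have := @ln_leB1 ((s / T) / ((s + e) / (T + e))).
rewrite ln_div ?posrE ?divr_gt0// => /(_ isT).
rewrite !ln_div ?posrE// /gam !addr0 => H.
have K : s / T / ((s + e) / (T + e)) - 1 <= (s - T) / T - (s - T) / (T + e).
  rewrite -subr_ge0.
  have -> : (s - T) / T - (s - T) / (T + e) - (s / T / ((s + e) / (T + e)) - 1)
     = e * (T - s) ^+ 2 / (T * (T + e) * (s + e)).
    by field; rewrite !lt0r_neq0.
  apply: divr_ge0; first by rewrite mulr_ge0// sqr_ge0.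
  by rewrite ltW// !mulr_gt0.
lra.
Qed.

Lemma continuous_kernel (a : R * R) (e : R) : 0 < e ->
  continuous (fun z : R * R => 4 * e / (sqd a z + e) ^+ 2).
Proof.
move=> e0 z; apply: cvgM; first exact: cvg_cst.
apply: cvgV; first by rewrite expf_neq0// lt0r_neq0// sqdDe_gt0.
by apply: cvgM; (apply: cvgD; [exact: continuous_sqd|exact: cvg_cst]).
Qed.

(** Green's identity for the constant 1. The mass never exceeds [4 pi] and tends to it as [e] tends
    to 0. *)
Lemma Rintegral_kernel (a : R * R) (T e : R) : 0 < T -> 0 < e ->
  \int[leb2]_(z in disc a T) (4 * e / (sqd a z + e) ^+ 2) = 4 / (T + e) * (pi * T).
Proof.
move=> T0 e0.
have d0 (x y : R) : is_derive x 1 (fun=> y) 0 by apply: is_derive_cst.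
have c0 (k : R) : continuous (fun _ : R * R => k) by move=> z; exact: cvg_cst.
have := @green_eps a T e (cst 1) (cst 0) (cst 0) (cst 0) (cst 0) e0
  (fun _ _ => d0 _ _) (fun _ _ => d0 _ _) (fun _ _ => d0 _ _) (fun _ _ => d0 _ _)
  (c0 1) (c0 0) (c0 0).
rewrite Rintegral_disc_cst// mul1r => /esym/eqP; rewrite subr_eq => /eqP.
under eq_Rintegral do rewrite mulr1.
move=> ->; rewrite [X in X + _](_ : _ = 0) ?add0r//.
under eq_Rintegral do rewrite addr0 mulr0.
by rewrite Rintegral_disc_cst// mul0r.
Qed.

(** For [w = sqd a] the Laplacian is 4, the kernel term is nonnegative, and [sqd a <= T] on the disc
    bounds the mean term. What remains does not depend on [e]. *)
Lemma Rintegral_gam_le (a : R * R) (T e : R) : 0 < T -> 0 < e ->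
  \int[leb2]_(z in disc a T) (- gam T e (sqd a z)) <= pi * T.
Proof.
move=> T0 e0.
have d1 (c k x : R) : is_derive x 1 (fun t => (t - c) ^+ 2 + k) (2 * (x - c)).
  apply: is_derive_eq; rewrite /GRing.scale/= subr0 addr0; ring.
have d2 (c x : R) : is_derive x 1 (fun t => 2 * (t - c)) 2.
  by apply: is_derive_eq; rewrite /GRing.scale/=; ring.
have d1' (c k x : R) : is_derive x 1 (fun t => k + (t - c) ^+ 2) (2 * (x - c)).
  by apply: is_derive_eq; rewrite /GRing.scale/= subr0 add0r; ring.
have c0 (k : R) : continuous (fun _ : R * R => k) by move=> z; exact: cvg_cst.
have := @green_eps a T e (sqd a) (fun z => 2 * (z.1 - a.1)) (cst 2) (fun z => 2 * (z.2 - a.2)) (cst 2) e0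
  (fun x y => d1 a.1 ((y - a.2) ^+ 2) x) (fun x y => d2 a.1 x)
  (fun x y => d1' a.2 ((x - a.1) ^+ 2) y) (fun x y => d2 a.2 y)
  (@continuous_sqd a) (c0 2) (c0 2).
have mD := measurable_disc a T.
have ig := continuous_disc_integrable a T (@continuous_gam_sqd a T e e0).
have isq := continuous_disc_integrable a T (@continuous_sqd a).
have -> : \int[leb2]_(z in disc a T) (gam T e (sqd a z) * (cst 2 z + cst 2 z)) =
    \int[leb2]_(z in disc a T) (gam T e (sqd a z) * 4).
  by apply: eq_Rintegral => z _ /=; ring.
rewrite RintegralZr// => E.
have F1 : 0 <= \int[leb2]_(z in disc a T) (4 * e / (sqd a z + e) ^+ 2 * sqd a z).
  apply: Rintegral_ge0 => z _; rewrite mulr_ge0 ?sqd_ge0// divr_ge0 ?sqr_ge0// mulr_ge0//.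
  exact: ltW.
have F2 : \int[leb2]_(z in disc a T) sqd a z <= T * (pi * T).
  rewrite -(Rintegral_disc_cst a T T0); apply: le_Rintegral => //.
  by apply: continuous_disc_integrable.
have F3 : 4 / (T + e) * \int[leb2]_(z in disc a T) sqd a z <= 4 * (pi * T).
  apply: (@le_trans _ _ (4 / (T + e) * (T * (pi * T)))).
    by rewrite ler_wpM2l// divr_ge0// addr_ge0// ltW.
  have -> : 4 / (T + e) * (T * (pi * T)) = T / (T + e) * (4 * (pi * T)) by ring.
  rewrite ler_piMl//; first by rewrite !mulr_ge0 ?pi_ge0// ltW.
  by rewrite ler_pdivrMr ?mul1r ?lerDl ?addr_gt0// ltW.
under eq_Rintegral do rewrite -mulN1r.
rewrite RintegralZl// mulN1r.
move: E F1 F3; move: (\int[leb2]_(z in disc a T) gam T e (sqd a z))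
  (\int[leb2]_(z in disc a T) (4 * e / (sqd a z + e) ^+ 2 * sqd a z))
  (4 / (T + e) * \int[leb2]_(z in disc a T) sqd a z) => I J K.
by clear -T0 e0; lra.
Qed.

Lemma measurable_gam0 (a : R * R) (T : R) :
  measurable_fun (setT : set P2) (fun z => gam T 0 (sqd a z)).
Proof.
have ms : measurable_fun (setT : set P2) (sqd a).
  by apply: continuous_measurable_prod; exact: continuous_sqd.
apply: measurable_funB.
  apply: measurable_funB; last exact: measurable_cst.
  by apply: measurableT_comp; [exact: measurable_ln|exact: measurable_funD].
by apply: measurable_funM; [exact: measurable_funB|exact: measurable_cst].
Qed.

Lemma cvg_gam (T s : R) : 0 < T -> 0 < s -> gam T (harmonic n) s @[n --> \oo] --> gam T 0 s.
Proof.
move=> T0 s0.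
have cD (k : R) : k + harmonic n @[n --> \oo] --> k + (0 : R).
  by apply: cvgD; [exact: cvg_cst|exact: cvg_harmonic].
have cl (k : R) : 0 < k -> ln (k + harmonic n) @[n --> \oo] --> ln (k + (0 : R)).
  by move=> k0; apply: (continuous_cvg _ _ (cD k)); apply: continuous_ln; rewrite addr0.
apply: cvgB; first by apply: cvgB; exact: cl.
apply: cvgM; first exact: cvg_cst.
by apply: cvgV => //; rewrite addr0 lt0r_neq0.
Qed.

Lemma sqd_gt0 (a z : R * R) : z != a -> 0 < sqd a z.
Proof.
move=> za; rewrite lt0r sqd_ge0 andbT; apply: contra za.
rewrite /sqd paddr_eq0 ?sqr_ge0// !sqrf_eq0 !subr_eq0 => /andP[/eqP h1 /eqP h2].
by apply/eqP; rewrite [z]surjective_pairing [a]surjective_pairing h1 h2.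
Qed.

Lemma set1_setX (a : R * R) : [set a] = [set a.1] `*` [set a.2] :> set P2.
Proof.
apply/seteqP; split=> [_ -> //|[x y] /= [-> ->]].
by rewrite [RHS]surjective_pairing.
Qed.

Lemma leb2_set1 (a : R * R) : leb2 [set a] = 0%E.
Proof.
rewrite set1_setX product_measure1E// [X in (X * _)%E](lebesgue_measure_set1 a.1).
by rewrite mul0e.
Qed.

Lemma measurable_pt (a : R * R) : measurable ([set a] : set P2).
Proof. by rewrite set1_setX; apply: measurableX. Qed.

(* Green's identity with [w = |x - a|^2] bounds the integrals of the
   regularised kernels uniformly, and Fatou's lemma passes to the limit. *)
Lemma gam0_integrable (a : R * R) (T : R) : 0 < T ->
  leb2.-integrable (disc a T) (EFin \o (fun z => gam T 0 (sqd a z))).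
Proof.
move=> T0; have mD := measurable_disc a T.
have ma := measurable_pt a.
(* At the centre [ln 0 = 0], while [gam T e 0] tends to minus infinity with [e]; the point is
   discarded as a null set. *)
pose D' : set P2 := disc a T `\` [set a].
have mD' : measurable D' by exact: measurableD.
have mg A : measurable A -> measurable_fun (A : set P2) (fun z => gam T 0 (sqd a z)).
  by move=> mA; apply: measurable_funS (measurable_gam0 a T).
apply/(negligible_integrable ma mD); [by apply/measurable_EFinP; exact: mg|exact: leb2_set1|].
pose f n (z : P2) : \bar R := (- gam T (harmonic n) (sqd a z))%:E.
have h0 n : 0 < harmonic n :> R by exact: harmonic_gt0.
have cg n : continuous (fun z : R * R => - gam T (harmonic n) (sqd a z)).
  by move=> z; apply: cvgN; exact: continuous_gam_sqd.
have mf n : measurable_fun D' (f n).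
  apply/measurable_EFinP.
  by apply: measurable_funS (continuous_measurable_prod (cg n)).
have f0 n z : disc a T z -> (0 <= f n z)%E.
  by move=> Dz; rewrite lee_fin oppr_ge0 gam_le0// sqdDe_gt0.
have D'P z : D' z -> 0 < sqd a z /\ sqd a z <= T.
  by move=> [Dz /eqP za]; split => //; exact: sqd_gt0.
have f0' n z : D' z -> (0 <= f n z)%E by move=> [/f0].
have bnd n : (\int[leb2]_(z in D') f n z <= (pi * T)%:E)%E.
  apply: (@le_trans _ _ (\int[leb2]_(z in disc a T) f n z)%E).
    apply: ge0_subset_integral => //; [|exact: f0|exact: subDsetl].
    apply/measurable_EFinP.
    by apply: measurable_funS (continuous_measurable_prod (cg n)).
  have ig := continuous_disc_integrable a T (cg n).
  have := Rintegral_gam_le a T0 (h0 n).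
  rewrite -lee_fin /Rintegral fineK; last exact: (integrable_fin_num mD ig).
  exact.
apply/integrableP; split; first by apply/measurable_EFinP; exact: mg.
have -> : (\int[leb2]_(z in D') `|(EFin \o (fun z => gam T 0 (sqd a z))) z| =
  \int[leb2]_(z in D') limn_einf (f ^~ z))%E.
  apply: eq_integral => z; rewrite inE => /D'P[z0 zT].
  have H : (f ^~ z) n @[n --> \oo] --> (- gam T 0 (sqd a z))%:E.
    by apply: cvg_EFin; [exact: nearW|apply: cvgN; exact: cvg_gam].
  by rewrite (cvg_limn_einf_sup H).1 /= ler0_norm// gam_le0// addr0.
apply: (le_lt_trans (fatou leb2 mD' mf f0')).
apply: (@le_lt_trans _ _ (pi * T)%:E); last exact: ltry.
rewrite limn_einf_lim; apply: lime_le; first exact: is_cvg_einfs.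
apply: nearW => n; apply: le_trans (bnd n).
by apply: ereal_inf_lbound; exists n => /=.
Qed.

Lemma near_center (a : R * R) (w : R * R -> R) (d : R) : continuous w -> 0 < d ->
  exists2 r, 0 < r & forall z, sqd a z < r -> `|w z - w a| <= d.
Proof.
move=> cw d0.
have : \forall z \near a, `|w a - w z| <= d.
  by have /cvgrPdist_le := cw a; exact.
move=> /nbhs_ballP[e /= e0 eP].
exists (e ^+ 2); first by rewrite exprn_gt0.
move=> z sz; rewrite distrC; apply: eP; move: sz; rewrite /sqd => sz.
have h1 := sqr_ge0 (z.1 - a.1); have h2 := sqr_ge0 (z.2 - a.2).
(* Balls of [R * R] are squares, so each coordinate is bounded separately. *)
split; rewrite /ball/= -(@ltr_pXn2r _ 2) ?nnegrE// ?(ltW e0)// real_normK ?num_real//.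
  by rewrite -sqrrN opprB; lra.
by rewrite -sqrrN opprB; lra.
Qed.

(** The kernels form an approximate identity: near [a] the factor [w] is small and the mass is at
    most [4 pi]; away from [a] the kernel is [O(e)]. *)
Lemma cvg_kernel0 (a : R * R) (T : R) (w : R * R -> R) : 0 < T -> continuous w -> w a = 0 ->
  \int[leb2]_(z in disc a T) (4 * harmonic n / (sqd a z + harmonic n) ^+ 2 * w z)
    @[n --> \oo] --> (0 : R).
Proof.
move=> T0 cw wa0; apply/cvgr0Pnorm_le => eps eps0.
have pi0 := pi_gt0 R.
(* Chosen so that the near part, at most [4 pi d], is at most [eps / 2]. *)
pose d := eps / (8 * pi).
have d0 : 0 < d by rewrite divr_gt0// mulr_gt0.
have [r r0 rP] := near_center a cw d0.
have [M [M0 MP]] := disc_bounded a T cw.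
(* The far part is at most [e * C]: the kernel is at most [4 e / r^2] there, since [r] bounds a
   squared distance. *)
pose C := 4 * M / r ^+ 2 * (pi * T).
have C0 : 0 <= C.
  by rewrite mulr_ge0// ?divr_ge0// ?mulr_ge0 ?sqr_ge0// ltW.
have : \forall n \near \oo, `|harmonic n| <= eps / (2 * (C + 1)) :> R.
  have /cvgr0Pnorm_le := @cvg_harmonic R; apply.
  by rewrite divr_gt0// mulr_gt0//; lra.
apply: filterS => n; move: (@harmonic_gt0 R n) => e0; rewrite gtr0_norm//.
move: (harmonic n) e0 => e e0 eC.
have mD := measurable_disc a T.
have ck := @continuous_kernel a e e0.
have k0 z : 0 <= 4 * e / (sqd a z + e) ^+ 2.
  by rewrite divr_ge0// ?sqr_ge0// mulr_ge0// ltW.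
have i1 : leb2.-integrable (disc a T) (EFin \o (fun z => 4 * e / (sqd a z + e) ^+ 2 * w z)).
  by apply: continuous_disc_integrable => z; apply: cvgM; [exact: ck|exact: cw].
have i2 : leb2.-integrable (disc a T) (EFin \o (fun z => d * (4 * e / (sqd a z + e) ^+ 2))).
  by apply: continuous_disc_integrable => z; apply: cvgM; [exact: cvg_cst|exact: ck].
have i2' : leb2.-integrable (disc a T) (EFin \o (fun z => 4 * e / (sqd a z + e) ^+ 2)).
  exact: continuous_disc_integrable.
have i3 : leb2.-integrable (disc a T) (EFin \o (fun z => 4 * e / r ^+ 2 * M)).
  by apply: continuous_disc_integrable => z; exact: cvg_cst.
apply: (le_trans (le_normr_Rintegral mD i1)).
apply: (@le_trans _ _ (\int[leb2]_(z in disc a T)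
    (d * (4 * e / (sqd a z + e) ^+ 2) + 4 * e / r ^+ 2 * M))).
  apply: le_Rintegral => //.
  - exact: (integrable_norm i1).
  - exact: (integrableD mD i2 i3).
  - move=> z Dz; rewrite normrM ger0_norm//.
    have [zr|zr] := ltP (sqd a z) r.
      have := rP _ zr; rewrite wa0 subr0 => wd.
      rewrite ler_wpDr//; first by rewrite mulr_ge0// divr_ge0 ?sqr_ge0// mulr_ge0// ltW.
      by rewrite mulrC ler_wpM2r.
    rewrite ler_wpDl//; first by rewrite mulr_ge0// ltW.
    apply: ler_pM => //; last exact: MP.
    rewrite ler_pM2l ?mulr_gt0// lef_pV2 ?posrE ?exprn_gt0 ?sqdDe_gt0//.
    by rewrite ler_pXn2r ?nnegrE ?(ltW r0) ?(ltW (sqdDe_gt0 _ _ _))//; lra.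
rewrite RintegralD// RintegralZl// Rintegral_kernel// Rintegral_disc_cst//.
have -> : 4 * e / r ^+ 2 * M * (pi * T) = e * C by rewrite /C; ring.
have h1 : d * (4 / (T + e) * (pi * T)) <= eps / 2.
  have -> : d * (4 / (T + e) * (pi * T)) = eps / 2 * (T / (T + e)).
    by rewrite /d; field; rewrite !lt0r_neq0//; lra.
  by rewrite ler_piMr ?divr_ge0 ?(ltW eps0)// ler_pdivrMr ?mul1r ?lerDl ?addr_gt0// ltW.
have h2 : e * C <= eps / 2.
  apply: (@le_trans _ _ (e * (C + 1))); first by rewrite ler_pM2l// lerDl.
  rewrite (le_trans (ler_wpM2r _ eC))//; first by lra.
  by rewrite le_eqVlt; apply/orP; left; apply/eqP; field; rewrite lt0r_neq0//; lra.
lra.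
Qed.

(** The limit of [green_eps] along [e = 1 / (n + 1)]; by [gam0_le] the left side is dominated by a
    multiple of [gam T 0]. *)
Lemma green_limit (a : R * R) (T : R) (w wx wxx wy wyy : R * R -> R) : 0 < T ->
  (forall x y : R, is_derive x 1 (fun t => w (t, y)) (wx (x, y))) ->
  (forall x y : R, is_derive x 1 (fun t => wx (t, y)) (wxx (x, y))) ->
  (forall x y : R, is_derive y 1 (fun t => w (x, t)) (wy (x, y))) ->
  (forall x y : R, is_derive y 1 (fun t => wy (x, t)) (wyy (x, y))) ->
  continuous w -> continuous wxx -> continuous wyy ->
  \int[leb2]_(z in disc a T) (gam T 0 (sqd a z) * (wxx z + wyy z)) =
  4 * pi * w a - 4 / T * \int[leb2]_(z in disc a T) w z.
Proof.
move=> T0 dx dxx dy dyy cw cxx cyy.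
have mD := measurable_disc a T.
(* With [w a] subtracted the kernel term tends to 0, and [4 pi w a] comes back from the mean term as
   [4 / T * (w a * (pi * T))]. *)
pose w0 z := w z - w a.
have cw0 : continuous w0 by move=> z; apply: cvgB; [exact: cw|exact: cvg_cst].
have dx0 (x y : R) : is_derive x 1 (fun t => w0 (t, y)) (wx (x, y)).
  by apply: is_derive_eq; rewrite subr0.
have dy0 (x y : R) : is_derive y 1 (fun t => w0 (x, t)) (wy (x, y)).
  by apply: is_derive_eq; rewrite subr0.
pose L z := wxx z + wyy z.
have cL : continuous L by move=> z; apply: cvgD; [exact: cxx|exact: cyy].
have [M [M0 MP]] := disc_bounded a T cL.
have h0 n : 0 < harmonic n :> R by exact: harmonic_gt0.
have ig := gam0_integrable a T0.
have E n := green_eps a T (h0 n) dx0 dxx dy0 dyy cw0 cxx cyy.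
have lim1 : \int[leb2]_(z in disc a T) (gam T (harmonic n) (sqd a z) * L z)
    @[n --> \oo] --> 0 - 4 / (T + 0) * \int[leb2]_(z in disc a T) w0 z.
  under eq_fun do rewrite E.
  apply: cvgB; first by apply: cvg_kernel0 => //; rewrite /w0 subrr.
  apply: cvgM; last exact: cvg_cst.
  apply: cvgM; first exact: cvg_cst.
  apply: cvgV; first by rewrite addr0 lt0r_neq0.
  by apply: cvgD; [exact: cvg_cst|exact: cvg_harmonic].
have mgL : measurable_fun (disc a T) (fun z => gam T 0 (sqd a z) * L z).
  apply: measurable_funM; first by apply: measurable_funS (measurable_gam0 a T).
  by apply: measurable_funS (continuous_measurable_prod cL).
have [] := @dominated_convergence _ _ _ leb2 (disc a T) mD
  (fun n z => (gam T (harmonic n) (sqd a z) * L z)%:E)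
  (fun z => (gam T 0 (sqd a z) * L z)%:E)
  (fun z => (M * `|gam T 0 (sqd a z)|)%:E).
- move=> n; apply/measurable_EFinP.
  apply: measurable_funS (continuous_measurable_prod _) => // z.
  by apply: cvgM; [exact: continuous_gam_sqd|exact: cL].
- exact/measurable_EFinP.
- exists [set a]; split; [exact: measurable_pt|exact: leb2_set1|].
  move=> z /=; apply: contra_notP => /eqP za Dz.
  apply: cvg_EFin; first exact: nearW.
  by apply: cvgM; [apply: cvg_gam => //; exact: sqd_gt0|exact: cvg_cst].
- exact: (integrableZl mD M (integrable_norm ig)).
- exists [set a]; split; [exact: measurable_pt|exact: leb2_set1|].
  move=> z /=; apply: contra_notP => /eqP za n Dz.
  rewrite lee_fin normrM mulrC ler_pM//; first exact: MP.
  have s0 := sqd_gt0 za.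
  rewrite ler0_norm ?gam_le0//; last by rewrite addr_gt0.
  rewrite ler0_norm ?gam_le0 ?addr0// lerN2; apply: gam0_le => //.
move=> iL _ lim2.
have lim3 : \int[leb2]_(z in disc a T) (gam T (harmonic n) (sqd a z) * L z)
    @[n --> \oo] --> \int[leb2]_(z in disc a T) (gam T 0 (sqd a z) * L z).
  apply: fine_cvg; rewrite fineK//; exact: (integrable_fin_num mD iL).
rewrite (cvg_unique _ lim3 lim1)// addr0 RintegralB//.
- by rewrite Rintegral_disc_cst//; field; exact: lt0r_neq0.
- exact: continuous_disc_integrable.
- by apply: continuous_disc_integrable => z; exact: cvg_cst.
Qed.

(** * Disc means of the logarithm *)

Definition eucl (a y : R * R) : R := Num.sqrt (sqd a y).

Lemma eucl_ge0 a y : 0 <= eucl a y. Proof. exact: sqrtr_ge0. Qed.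

Lemma eucl_sqr a y : eucl a y ^+ 2 = sqd a y.
Proof. by rewrite sqr_sqrtr// sqd_ge0. Qed.

Lemma eucl_sqr_le (r : R) a y : 0 <= r -> sqd a y <= r ^+ 2 -> eucl a y <= r.
Proof. by move=> r0 /ler_wsqrtr; rewrite sqrtr_sqr ger0_norm. Qed.

Lemma norm_fst_le_eucl a y : `|y.1 - a.1| <= eucl a y.
Proof. by rewrite -sqrtr_sqr ler_wsqrtr// lerDl sqr_ge0. Qed.

Lemma norm_snd_le_eucl a y : `|y.2 - a.2| <= eucl a y.
Proof. by rewrite -sqrtr_sqr ler_wsqrtr// lerDr sqr_ge0. Qed.

(** Measuring the shift in the [l^1] norm suffices and replaces Cauchy-Schwarz by [p q <= r |q|] in
    each coordinate. *)
Lemma eucl_triangle a b y :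
  eucl b y <= eucl a y + (`|a.1 - b.1| + `|a.2 - b.2|).
Proof.
have h0 := eucl_ge0 a y.
have h1 := norm_fst_le_eucl a y.
have h2 := norm_snd_le_eucl a y.
have h3 := eucl_sqr a y.
apply: eucl_sqr_le; first by rewrite !addr_ge0.
rewrite /sqd (_ : y.1 - b.1 = (y.1 - a.1) + (a.1 - b.1)); last by ring.
rewrite (_ : y.2 - b.2 = (y.2 - a.2) + (a.2 - b.2)); last by ring.
move: h0 h1 h2 h3; rewrite /sqd.
move: (eucl a y) (y.1 - a.1) (y.2 - a.2) (a.1 - b.1) (a.2 - b.2) => r p1 p2 q1 q2.
move=> r0 r1 r2 rE.
have k1 : p1 * q1 <= r * `|q1|.
  by rewrite (le_trans (ler_norm _))// normrM ler_wpM2r.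
have k2 : p2 * q2 <= r * `|q2|.
  by rewrite (le_trans (ler_norm _))// normrM ler_wpM2r.
have k3 : q1 ^+ 2 = `|q1| ^+ 2 by rewrite real_normK ?num_real.
have k4 : q2 ^+ 2 = `|q2| ^+ 2 by rewrite real_normK ?num_real.
have k5 : 0 <= `|q1| * `|q2| by rewrite mulr_ge0.
rewrite !sqrrD k3 k4; lra.
Qed.

(* The mean of [ln |x|^2] over the disc of radius [r] centred at distance
   [rho] from the origin. *)
Definition nu (r rho : R) : R := 2 * ln (Num.max rho r) + Num.min (rho / r) 1 ^+ 2 - 1.

Lemma nu_out (r rho : R) : 0 < r -> r <= rho -> nu r rho = 2 * ln rho.
Proof.
move=> r0 rr; rewrite /nu max_l// min_r ?expr1n ?addrK//.
by rewrite ler_pdivlMr ?mul1r.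
Qed.

(** The correction is the very kernel of [green_limit], which is why the two cancel in
    [representation]. *)
Lemma nu_in (r rho : R) : 0 < r -> 0 < rho -> rho <= r ->
  2 * ln rho = nu r rho + gam (r ^+ 2) 0 (rho ^+ 2).
Proof.
move=> r0 p0 pr; rewrite /nu max_r// min_l; last by rewrite ler_pdivrMr ?mul1r.
by rewrite /gam !addr0 !lnXn//; field; rewrite lt0r_neq0.
Qed.

Lemma ln_dist_le (r d x y : R) : 0 < r -> 0 <= d -> r <= x -> r <= y ->
  `|x - y| <= d -> `|ln x - ln y| <= d / r.
Proof.
have key (p q : R) : 0 < r -> 0 <= d -> r <= p -> r <= q -> p - q <= d -> ln p - ln q <= d / r.
  move=> r0 d0 rp rq pq.
  have q0 : 0 < q by lra.
  have p0 : 0 < p by lra.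
  rewrite -ln_div ?posrE// (le_trans (ln_leB1 _)) ?divr_gt0//.
  have -> : p / q - 1 = (p - q) / q by field; exact: lt0r_neq0.
  rewrite (@le_trans _ _ (d / q))//; first by rewrite ler_pM2r// invr_gt0.
  by rewrite ler_wpM2l// lef_pV2 ?posrE.
move=> r0 d0 rx ry; rewrite !ler_norml => /andP[h1 h2].
have := key x y r0 d0 rx ry; have := key y x r0 d0 ry rx => k1 k2.
by apply/andP; split; [rewrite lerNl opprB; apply: k1; lra|exact: k2].
Qed.

(** Of the constant 6, the logarithm contributes 2 by [ln_dist_le] and the square contributes 4: the
    capped quotients differ by at most [2 d / r] and their sum is at most 2. *)
Lemma nu_dist (r d x y : R) : 0 < r -> 0 <= d -> 0 <= x -> 0 <= y ->
  `|y - x| <= d -> `|nu (r + d) y - nu r x| <= 6 * d / r.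
Proof.
move=> r0 d0 x0 y0; rewrite ler_norml => /andP[h1 h2].
have rd : 0 < r + d by lra.
have L : `|ln (Num.max y (r + d)) - ln (Num.max x r)| <= d / r.
  apply: ln_dist_le => //.
  - by rewrite le_max; apply/orP; right; lra.
  - by rewrite le_max lexx orbT.
  - rewrite ler_norml; case: (leP y (r + d)); case: (leP x r) => *; apply/andP; split; lra.
pose p := Num.min (x / r) 1; pose q := Num.min (y / (r + d)) 1.
have dr0 : 0 <= d / r by rewrite divr_ge0// ltW.
have p01 : 0 <= p <= 1.
  by rewrite /p ge_min lexx orbT le_min ler01 !andbT divr_ge0// ltW.
have q01 : 0 <= q <= 1.
  by rewrite /q ge_min lexx orbT le_min ler01 !andbT divr_ge0// ltW.
have qp : q <= p + d / r.
  rewrite /q /p ge_min; case: (leP (x / r) 1) => xr; apply/orP; [left|right]; last by lra.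
  rewrite -mulrDl (@le_trans _ _ (y / r))//; last by rewrite ler_pM2r ?invr_gt0//; lra.
  by rewrite ler_wpM2l// lef_pV2 ?posrE//; lra.
have pq : p <= q + 2 * (d / r).
  move: p01; rewrite /q; case: (leP (y / (r + d)) 1) => yr p01; last by lra.
  rewrite /p ge_min; apply/orP; left.
  have -> : y / (r + d) + 2 * (d / r) = (y / (r + d) * r + 2 * d) / r.
    by field; rewrite !lt0r_neq0.
  rewrite ler_pM2r ?invr_gt0//.
  have := ler_wpM2r d0 yr; rewrite mul1r => yd.
  have : y / (r + d) * r + y / (r + d) * d = y by field; rewrite lt0r_neq0.
  lra.
have -> : 6 * d / r = 2 * (d / r) + 4 * (d / r) by field; rewrite lt0r_neq0.
have -> : nu (r + d) y - nu r x = 2 * (ln (Num.max y (r + d)) - ln (Num.max x r)) + (q - p) * (q + p).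
  by rewrite /nu -/p -/q; ring.
rewrite (le_trans (ler_normD _ _))// lerD//; first by rewrite normrM ger0_norm// ler_pM2l.
move: p01 q01 => /andP[p1 p2] /andP[q1 q2].
rewrite normrM (_ : 4 * (d / r) = 2 * (d / r) * 2); last by ring.
apply: ler_pM => //; first by rewrite ler_norml; apply/andP; split; lra.
by rewrite ger0_norm; lra.
Qed.

Lemma norm_mul_ln_le1 (x t : R) : `|x| <= t -> t <= 1 -> `|x| * `|ln t| <= 1.
Proof.
move=> xt t1; have := normr_ge0 x; rewrite le_eqVlt => /predU1P[<-|x0].
  by rewrite mul0r.
have t0 : 0 < t by exact: lt_le_trans xt.
rewrite (@ler0_norm _ (ln t)) ?ln_le0// -lnV ?posrE//.
apply: (@le_trans _ _ (t * (t^-1 - 1))).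
  apply: ler_pM => //; first by rewrite ln_ge0// invf_ge1.
  by rewrite ln_leB1// invr_gt0.
by rewrite mulrBr divff ?lt0r_neq0//; lra.
Qed.

(** Here [x] stands for the source at a point, [t] and [rho] for its distances to the origin and to
    the centre. The bound [|x| <= t] absorbs the singularity of [ln t] at 0; far out, [rho] and [t]
    are comparable and the logarithms nearly cancel. *)
Lemma nu_bound (r c rho t x : R) : 1 <= r -> 0 <= c -> 0 <= rho ->
  `|rho - t| <= c -> `|x| <= t ->
  `|x * (nu r rho - 2 * ln t)| <= (2 * ln (1 + r + c) + 1) * `|x| + (if t <= 1 then 2 else 0).
Proof.
move=> r1 c0 rho0; rewrite ler_norml => /andP[h1 h2] xt.
have r0 : 0 < r by lra.
have := normr_ge0 x; rewrite le_eqVlt => /predU1P[x0|x0].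
  have -> : x = 0 by apply/eqP; rewrite -normr_eq0 -x0.
  by rewrite normr0 mul0r mulr0 add0r normr0; case: ifP.
have t0 : 0 < t by exact: lt_le_trans xt.
pose m := Num.max rho r.
have mr : r <= m by rewrite le_max lexx orbT.
have mp : rho <= m by rewrite le_max lexx.
have m0 : 0 < m by lra.
have mle : m <= rho + r by rewrite ge_max; apply/andP; split; lra.
set K := 1 + r + c.
have K0 : 0 < K by rewrite /K; lra.
have K1 : 0 <= ln K by rewrite ln_ge0// /K; lra.
pose p := Num.min (rho / r) 1.
have p01 : 0 <= p <= 1.
  by rewrite /p ge_min lexx orbT le_min ler01 !andbT divr_ge0// ltW.
have pp : -1 <= p ^+ 2 - 1 <= 0.
  move: p01 => /andP[p0 p1]; have := sqr_ge0 p; have := exprn_ile1 2 p0 p1.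
  by move=> ? ?; apply/andP; split; lra.
have -> : nu r rho - 2 * ln t = 2 * (ln m - ln t) + (p ^+ 2 - 1).
  by rewrite /nu -/p -/m; ring.
rewrite normrM.
have P : `|p ^+ 2 - 1| <= 1 by rewrite ler_norml; move: pp => /andP[? ?]; apply/andP; split; lra.
case: ifPn => t1.
  (* For [t <= 1] the two logarithms are bounded separately; [norm_mul_ln_le1] yields the constant
     2. *)
  have mK : 0 <= ln m <= ln K.
    by rewrite ln_ge0 ?ler_ln ?posrE// /K; lra.
  have -> : 2 * (ln m - ln t) + (p ^+ 2 - 1) = (2 * ln m + (p ^+ 2 - 1)) + - (2 * ln t) by ring.
  rewrite (le_trans (ler_wpM2l (normr_ge0 x) (ler_normD _ _)))// mulrDr lerD//.
    rewrite mulrC ler_pM2r// (le_trans (ler_normD _ _))// lerD//.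
    move: mK => /andP[mK0 mK1]; rewrite ger0_norm ?mulr_ge0//; lra.
  rewrite normrN normrM ger0_norm// mulrCA.
  by have := norm_mul_ln_le1 xt t1; lra.
(* For [t > 1] it suffices that [t <= K m] and [m <= K t]. *)
rewrite addr0 mulrC ler_pM2r// (le_trans (ler_normD _ _))// lerD//.
rewrite normrM ger0_norm// ler_pM2l// ler_norml; rewrite -ltNge in t1.
have tr0 : 0 <= t * r by rewrite mulr_ge0// ltW.
apply/andP; split.
  rewrite lerNl opprB lerBlDr -lnM ?posrE// ler_ln ?posrE ?mulr_gt0//.
  have : 0 <= m * c by rewrite mulr_ge0// ltW.
  have : m <= m * r by rewrite ler_peMr// ltW.
  have : r <= m * r by rewrite ler_peMl//; lra.
  have : c <= m * c by rewrite ler_peMl//; lra.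
  by rewrite /K [(1 + r + c) * m](_ : _ = m + m * r + m * c); [lra|ring].
rewrite lerBlDr -lnM ?posrE// ler_ln ?posrE ?mulr_gt0//.
have : c <= t * c by rewrite ler_peMl//; lra.
have : r <= t * r by rewrite ler_peMl//; lra.
by rewrite /K [(1 + r + c) * t](_ : _ = t + t * r + t * c); [lra|ring].
Qed.

Lemma growth_le0 (D C : R) : (forall t, 1 <= t -> t * D <= C) -> D <= 0.
Proof.
move=> H; rewrite leNgt; apply/negP => D0.
have C0 : 0 <= C by have := H 1 (lexx _); lra.
have := H (1 + C / D); rewrite lerDl divr_ge0// ?(ltW D0)// => /(_ isT).
by rewrite mulrDl divfK ?lt0r_neq0//; lra.
Qed.

(** * The logarithmic potential *)

(** Serves the kernel identity of [vv_eq], which holds only away from the pole. *)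
Lemma Rintegral_eq_off_pt (a : R * R) (f g : P2 -> R) :
  measurable_fun setT f -> leb2.-integrable setT (EFin \o g) ->
  (forall y, y != a -> f y = g y) ->
  leb2.-integrable setT (EFin \o f) /\ \int[leb2]_y f y = \int[leb2]_y g y.
Proof.
move=> mf ig fg.
have ma := measurable_pt a; have a0 := leb2_set1 a.
have mDa : measurable ([set: P2] `\` [set a]) by exact: measurableD.
have fgD : {in [set: P2] `\` [set a], EFin \o g =1 EFin \o f}.
  by move=> y; rewrite inE => -[_ /eqP ya] /=; rewrite fg.
have iF : leb2.-integrable setT (EFin \o f).
  apply/(negligible_integrable ma measurableT); [exact/measurable_EFinP|exact: a0|].
  apply: (@eq_integrable _ _ _ leb2 _ mDa (EFin \o g) (EFin \o f) fgD).
  exact: (integrableS measurableT mDa (@subsetT _ _) ig).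
split=> //; rewrite /Rintegral; congr fine.
apply: (etrans (negligible_integral ma measurableT iF a0)).
apply: (etrans _ (esym (negligible_integral ma measurableT ig a0))).
by apply: eq_integral => y yD; exact: (esym (fgD y yD)).
Qed.

Lemma continuous_eucl (a : R * R) : continuous (eucl a).
Proof.
move=> y; apply: (continuous_comp (@continuous_sqd a y)).
exact: sqrt_continuous.
Qed.

Lemma measurable_eucl (a : R * R) : measurable_fun (setT : set P2) (eucl a).
Proof. by apply: continuous_measurable_prod; exact: continuous_eucl. Qed.

Lemma measurable_nu (a : R * R) (r : R) :
  measurable_fun (setT : set P2) (fun y => nu r (eucl a y)).
Proof.
have me := measurable_eucl a.
apply: measurable_funB; last exact: measurable_cst.
apply: measurable_funD.
  apply: measurable_funM; first exact: measurable_cst.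
  apply: measurableT_comp; first exact: measurable_ln.
  by apply: measurable_maxr => //; exact: measurable_cst.
apply: measurable_funX; apply: measurable_minr; last exact: measurable_cst.
by apply: measurable_funM => //; exact: measurable_cst.
Qed.

Lemma maxBmaxN (t : R) : Num.max t 0 - Num.max (- t) 0 = t.
Proof. by case: (leP t 0); case: (leP (- t) 0); lra. Qed.

Section potential.
Variable u : R * R -> R.
Hypothesis cu : continuous u.
Hypothesis u_le0 : forall x, u x <= 0.

Definition src (y : R * R) : R := y.1 * expR (u y).

Hypothesis isrc : leb2.-integrable setT (EFin \o (fun y => `|src y|)).

Lemma continuous_src : continuous src.
Proof.
move=> y; have h1 : (fun z : R * R => z.1) @ y --> y.1 by exact: cvg_fst.
have h2 : (fun z => expR (u z)) @ y --> expR (u y).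
  by apply: (@continuous_comp _ _ _ u (@expR R) y); [exact: cu|exact: continuous_expR].
exact: (cvgM h1 h2).
Qed.

Lemma measurable_src : measurable_fun (setT : set P2) src.
Proof. by apply: continuous_measurable_prod; exact: continuous_src. Qed.

(** Since [u <= 0], the exponential is at most 1. This linear vanishing at the origin is what
    [nu_bound] needs against [ln |y|]. *)
Lemma src_le (y : R * R) : `|src y| <= eucl (0, 0) y.
Proof.
rewrite /src normrM (ger0_norm (expR_ge0 _)).
apply: (@le_trans _ _ `|y.1|); first by rewrite ler_piMr// expR_le1.
by have := norm_fst_le_eucl (0, 0) y; rewrite /= subr0.
Qed.

(** Twice the logarithmic kernel of [v0] and [v1], averaged over the disc of radius [r] about
    [a]. *)
Definition pker (r : R) (a y : R * R) : R := nu r (eucl a y) - 2 * ln (eucl (0, 0) y).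

(** Height and support come from the last term of [nu_bound]. *)
Definition disc_bump : P2 -> R := (cst (2 : R) : P2 -> R) \_ (disc (0, 0) 1).
Definition pbound : R := \int[leb2]_y disc_bump y.
Definition mass : R := \int[leb2]_y `|src y|.
Definition norm1 (a : R * R) : R := `|a.1| + `|a.2|.

Lemma norm1_ge0 a : 0 <= norm1 a. Proof. by rewrite addr_ge0. Qed.

Lemma indic_integrable : leb2.-integrable setT (EFin \o disc_bump).
Proof.
have mD := measurable_disc ((0, 0) : R * R) 1.
rewrite /disc_bump -restrict_EFin; apply/(integrable_mkcond _ mD).
by apply: continuous_disc_integrable => z; exact: cvg_cst.
Qed.

Lemma eucl0_dist b y : `|eucl b y - eucl (0, 0) y| <= norm1 b.
Proof.
have h1 := eucl_triangle (0, 0) b y; have h2 := eucl_triangle b (0, 0) y.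
move: h1 h2; rewrite /= !subr0 !sub0r !normrN => h1 h2.
by rewrite ler_norml /norm1; apply/andP; split; lra.
Qed.

(** Integrates [nu_bound] with [x = src y] and [t = |y|]. Only logarithmic growth in [r] results,
    which the factor [r^2] in [comparison] outweighs. *)
Lemma potential_bound r b : 1 <= r ->
  leb2.-integrable setT (EFin \o (fun y => src y * pker r b y)) /\
  `|\int[leb2]_y (src y * pker r b y)| <= (2 * ln (1 + r + norm1 b) + 1) * mass + pbound.
Proof.
move=> r1; set C := 2 * ln (1 + r + norm1 b) + 1.
have iC := integrableZl measurableT C isrc.
have iB := integrableD measurableT iC indic_integrable.
have dom y : `|src y * pker r b y| <= C * `|src y| + disc_bump y.
  have := nu_bound r1 (norm1_ge0 b) (eucl_ge0 b y) (eucl0_dist b y) (src_le y).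
  move=> /le_trans; apply; rewrite lerD2l /disc_bump patchE; case: ifPn => [e1|_].
    rewrite mem_set//= /disc/= -eucl_sqr.
    by rewrite exprn_ile1// eucl_ge0.
  by case: ifP.
have mfk : measurable_fun (setT : set P2) (fun y => src y * pker r b y).
  apply: measurable_funM; first exact: measurable_src.
  apply: measurable_funB; first exact: measurable_nu.
  apply: measurable_funM; first exact: measurable_cst.
  by apply: measurableT_comp; [exact: measurable_ln|exact: measurable_eucl].
have iF : leb2.-integrable setT (EFin \o (fun y => src y * pker r b y)).
  apply: (le_integrable measurableT _ _ iB); first exact/measurable_EFinP.
  by move=> y _ /=; rewrite lee_fin (le_trans (dom y))// ler_norm.
split => //.
apply: (le_trans (le_normr_Rintegral measurableT iF)).
rewrite /mass /pbound -RintegralZl// -RintegralD//; last exact: indic_integrable.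
apply: le_Rintegral => //.
exact: (integrable_norm iF).
Qed.

(** The terms [ln |y|] cancel in the difference of kernels, and [nu_dist] controls the rest. *)
Lemma potential_diff r d a b : 1 <= r -> 0 <= d ->
  (forall y, `|eucl b y - eucl a y| <= d) ->
  `|\int[leb2]_y (src y * pker (r + d) b y) - \int[leb2]_y (src y * pker r a y)|
    <= 6 * d / r * mass.
Proof.
move=> r1 d0 ab; have r0 : 0 < r by lra.
have rd1 : 1 <= r + d by lra.
have [i1 _] := potential_bound b rd1.
have [i2 _] := potential_bound a r1.
rewrite -RintegralB//.
have i3 : leb2.-integrable setT (EFin \o (fun y => src y * pker (r + d) b y - src y * pker r a y)).
  exact: (integrableB measurableT i1 i2).
apply: (le_trans (le_normr_Rintegral measurableT i3)).
rewrite /mass -RintegralZl//; apply: le_Rintegral => //.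
- exact: (integrable_norm i3).
- exact: (integrableZl measurableT _ isrc).
- move=> y _; rewrite -mulrBr normrM mulrC ler_wpM2r//.
  rewrite /pker (_ : _ - _ = nu (r + d) (eucl b y) - nu r (eucl a y)); last by ring.
  by apply: nu_dist => //; exact: eucl_ge0.
Qed.

Lemma enormE (y : R * R) : enorm y = eucl (0, 0) y.
Proof. by rewrite /enorm /eucl /sqd /= !subr0. Qed.

Lemma enormBE (a y : R * R) : enorm (a - y) = eucl a y.
Proof.
rewrite /enorm /eucl /sqd /= -[(a.1 - y.1) ^+ 2]sqrrN -[(a.2 - y.2) ^+ 2]sqrrN.
by rewrite !opprB.
Qed.

Lemma src_gam_integrable a T : 0 < T ->
  leb2.-integrable (disc a T) (EFin \o (fun y => src y * gam T 0 (sqd a y))).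
Proof.
move=> T0; have mD := measurable_disc a T.
have [M [M0 MP]] := disc_bounded a T continuous_src.
apply: (le_integrable mD _ _ (integrableZl mD M (gam0_integrable a T0))).
  apply/measurable_EFinP; apply: measurable_funM.
    by apply: measurable_funS measurable_src.
  by apply: measurable_funS (measurable_gam0 a T).
by move=> y Dy /=; rewrite lee_fin normrM [leRHS]normrM (ger0_norm M0) ler_wpM2r//; exact: MP.
Qed.

(** By [nu_in] and [nu_out], twice the kernel of [v] is [pker] plus [gam] restricted to the disc,
    whatever the radius. *)
Lemma vv_eq r a : 1 <= r ->
  4 * pi * vv u a = \int[leb2]_y (src y * pker r a y)
    + \int[leb2]_(y in disc a (r ^+ 2)) (src y * gam (r ^+ 2) 0 (sqd a y)).
Proof.
move=> r1; have r0 : 0 < r by lra.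
have r20 : 0 < r ^+ 2 by rewrite exprn_gt0.
have [ip _] := potential_bound a r1.
have mD := measurable_disc a (r ^+ 2).
pose G y := src y * gam (r ^+ 2) 0 (sqd a y).
have mG : measurable_fun (setT : set P2) G.
  by apply: measurable_funM; [exact: measurable_src|exact: measurable_gam0].
have iG := src_gam_integrable a r20.
have iG' : leb2.-integrable setT (EFin \o (G \_ (disc a (r ^+ 2)))).
  by rewrite -restrict_EFin; apply/(integrable_mkcond _ mD).
pose L y := ln (enorm (a - y) / enorm y).
have mL : measurable_fun (setT : set P2) L.
  have ma := measurable_eucl a; have m0 := measurable_eucl (0, 0).
  (* Logarithms of quotients split only for positive arguments; if either distance is 0, the
     quotient is 0 because [0^-1 = 0]. *)
  have -> : L = fun y => if eucl a y * eucl (0, 0) y == 0 then ln 0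
      else ln (eucl a y) - ln (eucl (0, 0) y).
    apply/funext => y; rewrite /L enormBE enormE.
    case: ifPn; first by rewrite mulf_eq0 => /orP[] /eqP ->; rewrite ?invr0 ?mul0r ?mulr0.
    rewrite mulf_eq0 negb_or => /andP[h1 h2].
    by rewrite ln_div// posrE lt0r eucl_ge0 ?h1 ?h2.
  apply: measurable_fun_ifT; last 2 first.
  - exact: measurable_cst.
  - by apply: measurable_funB; apply: measurableT_comp => //; exact: measurable_ln.
  - by apply: measurable_fun_eqr; [exact: measurable_funM|exact: measurable_cst].
(* The factor [2^-1] undoes the squared distances inside [pker] and [gam]. *)
pose g y := 2^-1 * (src y * pker r a y + (G \_ (disc a (r ^+ 2))) y).
have ig : leb2.-integrable setT (EFin \o g).
  exact: (integrableZl measurableT 2^-1 (integrableD measurableT ip iG')).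
(* At [y = a] this fails, because [ln 0 = 0]. *)
have Lg y : y != a -> L y * src y = g y.
  (* At the origin both sides are 0 because [src] vanishes there. *)
  move=> ya; have [->|y0] := eqVneq y (0, 0).
    rewrite /g patchE /G /src /= !mul0r mulr0.
    by case: ifP; rewrite addr0 mulr0.
  have ea : 0 < eucl a y by rewrite sqrtr_gt0 sqd_gt0.
  have e0 : 0 < eucl (0, 0) y by rewrite sqrtr_gt0 sqd_gt0.
  rewrite /g /L enormBE enormE ln_div ?posrE// patchE /G /pker.
  case: ifPn; rewrite ?inE ?notin_setE /disc/= => yr.
    have er : eucl a y <= r by apply: eucl_sqr_le => //; exact: ltW.
    have := nu_in r0 ea er; rewrite eucl_sqr => E.
    by rewrite -mulrDr addrAC -E; field.
  have er : r <= eucl a y.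
    rewrite leNgt; apply/negP => er; apply: yr; rewrite -eucl_sqr.
    by rewrite ler_pXn2r ?nnegrE ?eucl_ge0// ltW.
  by rewrite (nu_out r0 er) (_ : point = 0 :> R)//; field.
have mLs : measurable_fun (setT : set P2) (fun y => L y * src y).
  by apply: measurable_funM => //; exact: measurable_src.
have [iL intL] := Rintegral_eq_off_pt mLs ig Lg.
have mu : measurable_fun (setT : set P2) (fun y => expR (u y)).
  by apply: measurableT_comp; [exact: measurable_expR|exact: continuous_measurable_prod].
have m1 : measurable_fun (setT : set P2) (fun y => y.1) by exact: measurable_fst.
(* Both potentials must converge separately before their difference becomes one integral; [|Kp|] and
   [|Km|] are at most [|y.1|], so [L * src] dominates both. *)
have ipart (K : R * R -> R) : measurable_fun (setT : set P2) K ->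
    (forall y, `|K y| <= `|y.1|) ->
    leb2.-integrable setT (EFin \o (fun y => L y * K y * expR (u y))).
  move=> mK Kle; apply: (le_integrable measurableT _ _ iL).
    by apply/measurable_EFinP; apply: measurable_funM => //; exact: measurable_funM.
  move=> y _ /=; rewrite lee_fin /src mulrA !normrM ler_wpM2r// ler_wpM2l//.
have iKp : leb2.-integrable setT (EFin \o (fun y => L y * Kp y * expR (u y))).
  apply: ipart => [|y]; first by apply: measurable_maxr => //; exact: measurable_cst.
  rewrite /Kp; case: (leP y.1 0) => y0; last by [].
  by rewrite normr0.
have iKm : leb2.-integrable setT (EFin \o (fun y => L y * Km y * expR (u y))).
  apply: ipart => [|y].
    by apply: measurable_maxr; [exact: measurable_funN|exact: measurable_cst].
  rewrite /Km; case: (leP (- y.1) 0) => y0; last by rewrite normrN.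
  by rewrite normr0.
have -> : vv u a = (2 * pi)^-1 * \int[leb2]_y (L y * src y).
  rewrite /vv /v0 /v1 -mulrBr; congr (_ * _).
  rewrite -[LHS](RintegralB measurableT iKp iKm).
  apply: eq_Rintegral => y _; rewrite -mulrBl -mulrBr /src mulrA; congr (_ * _ * _).
  exact: maxBmaxN.
rewrite intL /g RintegralZl//; last exact: (integrableD measurableT ip iG').
rewrite RintegralD// -Rintegral_mkcond /G.
have p0 := lt0r_neq0 (pi_gt0 R).
by move: (pi : R) p0 => p p0; field.
Qed.
End potential.

(** * Comparison of discs *)

Lemma Rintegral_disc_antimono (a b : R * R) (S T : R) (u : R * R -> R) :
  continuous u -> (forall x, u x <= 0) -> disc a S `<=` disc b T ->
  \int[leb2]_(y in disc b T) u y <= \int[leb2]_(y in disc a S) u y.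
Proof.
move=> cu u0 AB; rewrite [leLHS]Rintegral_mkcond [leRHS]Rintegral_mkcond.
have ir c Q : leb2.-integrable setT (EFin \o ((u : P2 -> R) \_ (disc c Q))).
  have mD := measurable_disc c Q.
  rewrite -restrict_EFin; apply/(integrable_mkcond _ mD).
  exact: continuous_disc_integrable.
apply: le_Rintegral => // y _; rewrite !patchE.
case: ifPn => [_|]; last first.
  by rewrite notin_setE => yB; rewrite memNset// => /AB.
by case: ifP => // _; exact: u0.
Qed.

(** Clearing denominators, [Ib <= Ia] reads [(r + d)^2 (Hb - Vb) <= r^2 (Ha - Va)]. The excess
    [(r + d)^2 - r^2 = 2 r d + d^2] then multiplies [Vb - Hb]. *)
Lemma comparison_arith (r d Ha Hb Va Vb Ia Ib F B : R) : 0 < r -> 0 <= d ->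
  Ha = 4 / r ^+ 2 * Ia + Va -> Hb = 4 / (r + d) ^+ 2 * Ib + Vb ->
  `|Vb| <= B -> `|Vb - Va| <= 6 * d / r * F -> Ib <= Ia ->
  r ^+ 2 * (Hb - Ha) <= (2 * r * d + d ^+ 2) * (`|Hb| + B) + r * (6 * d * F).
Proof.
move=> r0 d0 Ea Eb hB hV hI; have rd0 : 0 < r + d by lra.
have k1 : 4 * Ia = r ^+ 2 * (Ha - Va) by rewrite Ea; field; rewrite lt0r_neq0.
have k2 : 4 * Ib = (r + d) ^+ 2 * (Hb - Vb) by rewrite Eb; field; rewrite lt0r_neq0.
have k3 : r ^+ 2 * (Vb - Va) <= r * (6 * d * F).
  have -> : r * (6 * d * F) = r ^+ 2 * (6 * d / r * F) by field; rewrite lt0r_neq0.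
  by rewrite ler_pM2l ?exprn_gt0// (le_trans (ler_norm _)).
have k4 : (2 * r * d + d ^+ 2) * (Vb - Hb) <= (2 * r * d + d ^+ 2) * (`|Hb| + B).
  rewrite ler_wpM2l//; first by rewrite addr_ge0 ?sqr_ge0// !mulr_ge0// ltW.
  have := ler_norm Vb; have := ler_norm (- Hb); rewrite normrN; lra.
clear Ea Eb; lra.
Qed.

(** Taking [r = t^2] makes the logarithm at most linear in [t], so the right side is [O(t^3)]
    against [t^4 D]; dividing by [t^3] leads to [growth_le0]. *)
Lemma entire_arith (d c F P H D : R) : 0 <= d -> 0 <= c -> 0 <= F -> 0 <= P ->
  (forall r, 1 <= r -> r ^+ 2 * D <= (2 * r * d + d ^+ 2) *
    (`|H| + (2 * ln (1 + (r + d) + c) + 1) * F + P) + r * (6 * d * F)) ->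
  D <= 0.
Proof.
move=> d0 c0 F0 P0 HD.
pose C0 := 2 + d + c.
have C01 : 1 <= C0 by rewrite /C0; lra.
pose X := `|H| + (2 * C0 + 5) * F + P.
apply: (growth_le0 (C := (2 * d + d ^+ 2) * X + 6 * d * F)) => t t1.
have t0 : 0 < t by lra.
have r1 : 1 <= t ^+ 2 by rewrite exprn_ege1.
have := HD _ r1.
(* The argument is at most [C0 t^2], and [ln C0 <= C0], [ln t <= t]. *)
have lnle : ln (1 + (t ^+ 2 + d) + c) <= C0 + 2 * t.
  apply: (@le_trans _ _ (ln (C0 * t ^+ 2))).
    rewrite ler_ln ?posrE ?mulr_gt0 ?exprn_gt0//; [|lra|lra].
    have : 0 <= (1 + d + c) * (t ^+ 2 - 1) by rewrite mulr_ge0//; lra.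
    rewrite /C0; lra.
  rewrite lnM ?posrE ?exprn_gt0//; last lra.
  rewrite lnXn// -mulr_natl lerD//.
    by have := ln_leB1 (lt_le_trans ltr01 C01); lra.
  by have := ln_leB1 t0; lra.
move: (ln _) lnle => L lnle; clearbody C0.
(* As [t >= 1], [2 L + 1 <= 2 C0 + 1 + 4 t <= t (2 C0 + 5)]. *)
have X1 : `|H| + (2 * L + 1) * F + P <= t * X.
  rewrite /X !mulrDr; apply: lerD; last by rewrite ler_peMl.
  apply: lerD; first by rewrite ler_peMl.
  rewrite [leRHS]mulrA ler_wpM2r//.
  have : 0 <= (t - 1) * (2 * C0 + 1) by rewrite mulr_ge0//; lra.
  lra.
have X0 : 0 <= X by rewrite /X !addr_ge0// mulr_ge0//; lra.
have k1 : 2 * t ^+ 2 * d + d ^+ 2 <= t ^+ 2 * (2 * d + d ^+ 2).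
  have : 0 <= (t ^+ 2 - 1) * d ^+ 2 by rewrite mulr_ge0 ?sqr_ge0//; lra.
  lra.
have q0 : 0 <= 2 * t ^+ 2 * d + d ^+ 2 by rewrite addr_ge0 ?sqr_ge0// !mulr_ge0// ltW.
have tX : 0 <= t * X by rewrite mulr_ge0// ltW.
have k2 := le_trans (ler_wpM2l q0 X1) (ler_wpM2r tX k1).
have k3 : t ^+ 2 * (6 * d * F) <= t ^+ 3 * (6 * d * F).
  rewrite ler_wpM2r//; first by rewrite !mulr_ge0.
  by rewrite exprS ler_peMl// sqr_ge0.
move=> k4; rewrite -(@ler_pM2l _ (t ^+ 3)) ?exprn_gt0//.
have e1 : t ^+ 3 * (t * D) = (t ^+ 2) ^+ 2 * D by ring.
have e2 : t ^+ 2 * (2 * d + d ^+ 2) * (t * X) = t ^+ 3 * ((2 * d + d ^+ 2) * X) by ring.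
by rewrite e1 (le_trans k4)// [leRHS]mulrDr lerD// -e2.
Qed.

(** * Representation of [u + v] by disc means, and the limit of large radii *)

Section entire.
Variable u : R * R -> R.
Hypothesis su : smooth2 u.
Hypothesis eqn : forall x, - laplacian u x = src u x.
Hypothesis u_le0 : forall x, u x <= 0.
Hypothesis isrc : leb2.-integrable setT (EFin \o (fun y => `|src u y|)).

Let cu : continuous u. Proof. exact: (su [::]).1. Qed.

(** Adds [green_limit] for [u] to [vv_eq]: since the Laplacian of [u] is [- src u], the two
    integrals of [gam] cancel. *)
Lemma representation r a : 1 <= r ->
  4 * pi * (u a + vv u a) = 4 / r ^+ 2 * \int[leb2]_(y in disc a (r ^+ 2)) u y
    + \int[leb2]_y (src u y * pker r a y).
Proof.
move=> r1; have r20 : 0 < r ^+ 2 by rewrite exprn_gt0//; lra.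
rewrite mulrDr (vv_eq cu u_le0 isrc a r1).
have d1 s (x y : R) : is_derive x 1 (fun t => iter_pd s u (t, y)) (iter_pd (true :: s) u (x, y)).
  by have [_ /(_ (x, y)) [h _]] := su s; apply: DeriveDef => //; rewrite /= /pd1 derive1E.
have d2 s (x y : R) : is_derive y 1 (fun t => iter_pd s u (x, t)) (iter_pd (false :: s) u (x, y)).
  by have [_ /(_ (x, y)) [_ h]] := su s; apply: DeriveDef => //; rewrite /= /pd2 derive1E.
have := green_limit a r20 (d1 [::]) (d1 [:: true]) (d2 [::]) (d2 [:: false]) cu
  (su [:: true; true]).1 (su [:: false; false]).1.
have -> : \int[leb2]_(z in disc a (r ^+ 2)) (gam (r ^+ 2) 0 (sqd a z) *
    (iter_pd [:: true; true] u z + iter_pd [:: false; false] u z)) =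
    \int[leb2]_(z in disc a (r ^+ 2)) (-1 * (src u z * gam (r ^+ 2) 0 (sqd a z))).
  apply: eq_Rintegral => z _; rewrite -eqn /laplacian /=; ring.
rewrite RintegralZl; [|exact: measurable_disc|exact: src_gam_integrable].
rewrite /=; move: (Rintegral _ _ _) (Rintegral _ _ _) (Rintegral _ _ _) => p q s E.
by lra.
Qed.

Lemma comparison r d a b : 1 <= r -> 0 <= d ->
  (forall y, `|eucl b y - eucl a y| <= d) ->
  r ^+ 2 * (4 * pi * (u b + vv u b) - 4 * pi * (u a + vv u a)) <=
    (2 * r * d + d ^+ 2) * (`|4 * pi * (u b + vv u b)|
      + (2 * ln (1 + (r + d) + norm1 b) + 1) * mass u + pbound) + r * (6 * d * mass u).
Proof.
move=> r1 d0 ab; have r0 : 0 < r by lra.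
have rd1 : 1 <= r + d by lra.
have rd0 : 0 < r + d by lra.
have Ea := representation a r1; have Eb := representation b rd1.
have [_ Vb] := potential_bound cu u_le0 isrc b rd1.
have Vd := potential_diff cu u_le0 isrc r1 d0 ab.
have sub : disc a (r ^+ 2) `<=` disc b ((r + d) ^+ 2).
  move=> y; rewrite /disc/= => /(eucl_sqr_le (ltW r0)) yr.
  rewrite -eucl_sqr ler_pXn2r ?nnegrE ?eucl_ge0 ?(ltW rd0)//.
  by rewrite -(subrK (eucl a y) (eucl b y)) addrC lerD// (le_trans (ler_norm _)).
have hI := Rintegral_disc_antimono cu u_le0 sub.
by rewrite -[_ + _ + pbound]addrA; exact: (comparison_arith r0 d0 Ea Eb Vb Vd hI).
Qed.

Lemma entire_le a b : 4 * pi * (u b + vv u b) <= 4 * pi * (u a + vv u a).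
Proof.
pose d := `|a.1 - b.1| + `|a.2 - b.2|.
have d0 : 0 <= d by rewrite addr_ge0.
have ab y : `|eucl b y - eucl a y| <= d.
  have := eucl_triangle a b y; have := eucl_triangle b a y.
  rewrite [`|b.1 - _|]distrC [`|b.2 - _|]distrC -/d => h1 h2.
  by rewrite ler_norml; apply/andP; split; lra.
rewrite -subr_le0.
apply: (entire_arith d0 (norm1_ge0 b)) => [||r r1]; last exact: comparison.
  exact: Rintegral_ge0.
by apply: Rintegral_ge0 => y _; rewrite /disc_bump patchE; case: ifP.
Qed.

End entire.
End Plane.

Local Close Scope classical_set_scope.
Theorem theorem6 (R : realType) (u : R * R -> R) :
  smooth2 u ->
  (forall x : R * R, - laplacian u x = x.1 * expR (u x)) ->
  u (0, 0) = 0 ->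
  (forall x : R * R, u x <= u (0, 0)) ->
  (@leb2 R).-integrable setT (fun x : R * R => (`|x.1| * expR (u x))%:E) ->
  (0 < \int[@leb2 R]_(x in setT) (x.1 * expR (u x))%:E)%E ->
  exists c : R, forall x : R * R, u x + vv u x = c.
Proof.
move=> su eqn u0 ule isrc _.
have u_le0 x : u x <= 0 by rewrite -u0.
have isrc' : (@leb2 R).-integrable setT (EFin \o (fun y => `|src u y|)).
  rewrite (_ : _ \o _ = (fun x : R * R => (`|x.1| * expR (u x))%:E))//.
  by apply/funext => x; rewrite /= /src normrM (ger0_norm (expR_ge0 _)).
have le a b := entire_le su eqn u_le0 isrc' a b.
have pi40 : 4 * (pi : R) != 0 by rewrite mulf_neq0// lt0r_neq0// pi_gt0.
exists (u (0, 0) + vv u (0, 0)) => x.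
(* [entire_le] holds for every ordered pair of points, so the values at [x] and at the origin
   agree. *)
by apply: (mulfI pi40); apply: le_anti; apply/andP; split; exact: le.
Qed.
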